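(* For any field $k$, there is a strict symmetric monoidal functor $T \colon \widetilde{\mathrm{Circ}}_k \to \mathrm{SigFlow}_k$ giving a commutative square of strict symmetric monoidal functors \[ \square \circ T \;=\; J \circ \blacksquare \circ P \;\colon\; \widetilde{\mathrm{Circ}}_k \to \mathrm{FinRel}_k , \] where $P \colon \widetilde{\mathrm{Circ}}_k \to \mathrm{Circ}_k$, $\blacksquare \colon \mathrm{Circ}_k \to \mathrm{LagRel}_k$, $\square\colon \mathrm{SigFlow}_k\to\mathrm{FinRel}_k$ are the morphisms of props described in the context and $J \colon \mathrm{LagRel}_k \hookrightarrow \mathrm{FinRel}_k$ is the inclusion.
   Context: Props. A prop is a strict symmetric monoidal category having the natural numbers as objects, with tensor product of objects given by addition; a morphism of props is a strict symmetric monoidal functor that is the identity on objects. $+$ denotes coproduct in the category of props. A signature is a family of sets $\Sigma(m,n)$, $m,n\in\mathbb{N}$, whose elements are written $f\colon m\to n$; $F$ denotes the free prop on a signature. Throughout, $\Sigma$ is the signature with exactly the elements $\mu\colon2\to1$, $\iota\colon0\to1$, $\delta\colon1\to2$, $\epsilon\colon1\to0$, and $F(k)$ is the free prop on the signature with one operation $1\to1$ for each element of $k$ and no others. $\mathrm{FinRel}_k$ is the prop where a morphism $m\to n$ is a linear relation from $k^m$ to $k^n$, i.e. a linear subspace of $k^m\oplus k^n$, with the usual composition of relations and direct sum as tensor product. $\mathrm{LagRel}_k$. A symplectic vector space is a finite-dimensional vector space with a bilinear, alternating, nondegenerate form $\omega$. A subspace $L$ is isotropic if $\omega$ vanishes on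 $L\times L$, and Lagrangian if it is a maximal isotropic subspace. $\overline V$ is $V$ with form $-\omega$. A linear Lagrangian relation from $V$ to $V'$ is a Lagrangian subspace of $\overline V\oplus V'$. $k\oplus k$ has the form $\omega((\phi,I),(\phi',I'))=\phi I'-\phi'I$ and $(k\oplus k)^n$ the direct sum form. $\mathrm{LagRel}_k$ is the prop where a morphism $m\to n$ is a linear Lagrangian relation from $(k\oplus k)^m$ to $(k\oplus k)^n$, with composition of relations and direct sum. The inclusion $J\colon\mathrm{LagRel}_k\hookrightarrow\mathrm{FinRel}_k$ is the strict symmetric monoidal functor sending the object $n$ to $2n$ (since $(k\oplus k)^n=k^{2n}$) and each linear Lagrangian relation to itself. $\mathrm{SigFlow}_k = F(\Sigma)+F(\Sigma)+F(k)$. The generators of the first $F(\Sigma)$ are called coduplication $\Delta^\dagger\colon2\to1$, codeletion $!^\dagger\colon0\to1$, duplication $\Delta\colon1\to2$, deletion $!\colon1\to0$; those of the second are addition $+\colon2\to1$, zero $0\colon0\to1$, coaddition $+^\dagger\colon1\to2$, cozero $0^\dagger\colon1\to0$; those of $F(k)$ are scalar multiplications $c\colon1\to1$, $c\in k$. The morphism of props $\square\colon\mathrm{SigFlow}_k\to\mathrm{FinRel}_k$ is defined on generators by: $\Delta\mapsto\{(x,x,x)\}\subseteq k\oplus k^2$; $!\mapsto\{(x,0)\}\subseteq k\oplus\{0\}$; $\Delta^\dagger\mapsto\{(x,x,x)\}\subseteq k^2\oplus k$; $!^\dagger\mapsto\{(0,x)\}\subseteq\{0\}\oplus k$ (with $x$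 ranging over $k$); $+\mapsto\{(x,y,x+y)\}\subseteq k^2\oplus k$; $0\mapsto\{(0,0)\}\subseteq\{0\}\oplus k$ (the zero linear map $\{0\}\to k$); $+^\dagger\mapsto\{(x+y,x,y)\}\subseteq k\oplus k^2$; $0^\dagger\mapsto\{(0,0)\}\subseteq k\oplus\{0\}$ (the transpose relation of $0$); $c\mapsto\{(x,cx)\}\subseteq k\oplus k$. Circuits. For a set $\mathcal{L}$, an $\mathcal{L}$-circuit from a finite set $X$ to a finite set $Y$ is a cospan of finite sets $X\xrightarrow{i}N\xleftarrow{o}Y$ with a finite set $E$ of edges and maps $s,t\colon E\to N$, $\ell\colon E\to\mathcal{L}$. $\mathrm{Circ}_{\mathcal{L}}$ is the prop whose morphisms $m\to n$ are isomorphism classes of $\mathcal{L}$-circuits from an $m$-element ordinal to an $n$-element ordinal, composed by pushout of cospans with disjoint union of edges, and tensored by disjoint union. $\mathrm{FinCospan}$ is the prop of isomorphism classes of cospans of finite sets between finite ordinals (composition by pushout, tensor by disjoint union). One identifies $\mathrm{Circ}_{\mathcal{L}}\cong\mathrm{FinCospan}+F(\mathcal{L})$, where $F(\mathcal{L})$ is the free prop on one operation $1\to1$ per element of $\mathcal{L}$: cospans correspond to circuits without edges, and $\ell\in\mathcal{L}$ corresponds to the circuit $1\to1$ with two nodes and a single edge labeled $\ell$ from the input node to the output node. $\mathrm{Circ}_k$ is the case where $\mathcal{L}$ is the set of elements of $k$. $\widetilde{\mathrm{Circ}}_k=F(\Sigma)+F(k)$. The morphism of props $P\colon\widetilde{\mathrm{Circ}}_k\to\mathrm{Circ}_k\cong\mathrm{FinCospan}+F(k)$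 is the identity on $F(k)$ and sends $\mu,\iota,\delta,\epsilon$ to the cospans $2\to1\leftarrow1$, $0\to1\leftarrow1$, $1\to1\leftarrow2$, $1\to1\leftarrow0$ respectively (it is the quotient map imposing on the object $1$ the laws of a special commutative Frobenius monoid). Black-boxing $\blacksquare\colon\mathrm{Circ}_k\to\mathrm{LagRel}_k$ is the unique morphism of props sending the cospans $2\to1\leftarrow1$, $0\to1\leftarrow1$, $1\to1\leftarrow2$, $1\to1\leftarrow0$, again denoted $\mu,\iota,\delta,\epsilon$ respectively (which generate $\mathrm{FinCospan}$), and each $Z\in k$ to $\blacksquare(\mu)=\{(\phi_1,I_1,\phi_2,I_2,\phi_3,I_3):\phi_1=\phi_2=\phi_3,\ I_1+I_2=I_3\}$, $\blacksquare(\iota)=\{(\phi_2,I_2):I_2=0\}$, $\blacksquare(\delta)=\{(\phi_1,I_1,\phi_2,I_2,\phi_3,I_3):\phi_1=\phi_2=\phi_3,\ I_1=I_2+I_3\}$, $\blacksquare(\epsilon)=\{(\phi_1,I_1):I_1=0\}$, $\blacksquare(Z)=\{(\phi_1,I_1,\phi_2,I_2):\phi_2-\phi_1=ZI_1,\ I_1=I_2\}$. *)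

(* Defs.v *)
From HB Require Import structures.
From mathcomp Require Import all_boot all_order all_algebra.
From mathcomp Require Import boolp ring.

Set Implicit Arguments.
Unset Strict Implicit.
Unset Printing Implicit Defensive.

Import GRing.Theory.
Local Open Scope nat_scope.

(* Strictness of the tensor product holds only up to propositional equality of
   the objects, so morphisms are transported along such equalities. *)
Definition castm (H : nat -> nat -> Type) m m' n n'
    (em : m = m') (en : n = n') (f : H m n) : H m' n' :=
  ecast i (H i n') em (ecast j (H m j) en f).
Arguments castm : simpl never.

(* Hom-sets are setoids: [eqv] is the equality of morphisms, so that
   isomorphism classes and free constructions need no quotient types.
   Composition is written in diagrammatic order. *)
Record propcat := PropCat {
  hom :> nat -> nat -> Type;
  eqv : forall m n, hom m n -> hom m n -> Prop;
  idm : forall n, hom n n;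
  pcomp : forall m n p, hom m n -> hom n p -> hom m p;
  tens : forall m n m' n', hom m n -> hom m' n' -> hom (m + m') (n + n');
  swap : forall m n, hom (m + n) (n + m);
  eqv_refl : forall m n (f : hom m n), eqv f f;
  eqv_sym : forall m n (f g : hom m n), eqv f g -> eqv g f;
  eqv_trans : forall m n (f g h : hom m n), eqv f g -> eqv g h -> eqv f h;
  pcomp_eqv : forall m n p (f f' : hom m n) (g g' : hom n p),
    eqv f f' -> eqv g g' -> eqv (pcomp f g) (pcomp f' g');
  tens_eqv : forall m n m' n' (f f' : hom m n) (g g' : hom m' n'),
    eqv f f' -> eqv g g' -> eqv (tens f g) (tens f' g');
  pcompA : forall m n p q (f : hom m n) (g : hom n p) (h : hom p q),
    eqv (pcomp f (pcomp g h)) (pcomp (pcomp f g) h);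
  pcomp1l : forall m n (f : hom m n), eqv (pcomp (idm m) f) f;
  pcomp1r : forall m n (f : hom m n), eqv (pcomp f (idm n)) f;
  tens_id : forall m n, eqv (tens (idm m) (idm n)) (idm (m + n));
  tens_pcomp : forall m n p m' n' p' (f : hom m n) (g : hom n p)
      (f' : hom m' n') (g' : hom n' p'),
    eqv (tens (pcomp f g) (pcomp f' g')) (pcomp (tens f f') (tens g g'));
  tensA : forall m n m' n' m'' n''
      (f : hom m n) (g : hom m' n') (h : hom m'' n''),
    eqv (castm (addnA m m' m'') (addnA n n' n'') (tens f (tens g h)))
        (tens (tens f g) h);
  tens0l : forall m n (f : hom m n), eqv (tens (idm 0) f) f;
  tens0r : forall m n (f : hom m n),
    eqv (castm (addn0 m) (addn0 n) (tens f (idm 0))) f;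
  swap_nat : forall m n m' n' (f : hom m n) (g : hom m' n'),
    eqv (pcomp (tens f g) (swap n n')) (pcomp (swap m m') (tens g f));
  swapK : forall m n, eqv (pcomp (swap m n) (swap n m)) (idm (m + n));
  swap_hex : forall m n p,
    eqv (swap m (n + p))
        (castm (esym (addnA m n p)) (addnA n p m)
           (pcomp (castm erefl (esym (addnA n m p)) (tens (swap m n) (idm p)))
                  (tens (idm n) (swap m p))))
}.

Arguments eqv {_ _ _}.
Arguments idm {_} n.
Arguments pcomp {_ _ _ _}.
Arguments tens {_ _ _ _ _}.
Arguments swap {_} m n.

(* Strict symmetric monoidal functors identical on objects. *)
Record prop_morph (A B : propcat) := PropMorph {
  pm :> forall m n, A m n -> B m n;
  pm_eqv : forall m n (f g : A m n), eqv f g -> eqv (pm f) (pm g);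
  pm_id : forall n, eqv (pm (idm n)) (idm n);
  pm_pcomp : forall m n p (f : A m n) (g : A n p),
    eqv (pm (pcomp f g)) (pcomp (pm f) (pm g));
  pm_tens : forall m n m' n' (f : A m n) (g : A m' n'),
    eqv (pm (tens f g)) (tens (pm f) (pm g));
  pm_swap : forall m n, eqv (pm (swap m n)) (swap m n)
}.

Arguments pm {_ _} _ {_ _}.

(* Strict symmetric monoidal functors with an arbitrary action on objects. *)
Record smfunctor (A B : propcat) := SMFunctor {
  fobj : nat -> nat;
  fobj0 : fobj 0 = 0;
  fobjD : forall m n, fobj (m + n) = fobj m + fobj n;
  fhom :> forall m n, A m n -> B (fobj m) (fobj n);
  fhom_eqv : forall m n (f g : A m n), eqv f g -> eqv (fhom f) (fhom g);
  fhom_id : forall n, eqv (fhom (idm n)) (idm (fobj n));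
  fhom_pcomp : forall m n p (f : A m n) (g : A n p),
    eqv (fhom (pcomp f g)) (pcomp (fhom f) (fhom g));
  fhom_tens : forall m n m' n' (f : A m n) (g : A m' n'),
    eqv (fhom (tens f g))
        (castm (esym (fobjD m m')) (esym (fobjD n n')) (tens (fhom f) (fhom g)));
  fhom_swap : forall m n,
    eqv (fhom (swap m n))
        (castm (esym (fobjD m n)) (esym (fobjD n m)) (swap (fobj m) (fobj n)))
}.

Arguments fobj {_ _} _.
Arguments fhom {_ _} _ {_ _}.

Definition smf_eq (A B : propcat) (F G : smfunctor A B) : Prop :=
  exists e : forall n, fobj F n = fobj G n,
  forall m n (f : A m n), eqv (castm (e m) (e n) (fhom F f)) (fhom G f).

Section Cast.
Variable A : propcat.

Lemma castm_comp (H : nat -> nat -> Type) m m' m'' n n' n''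
  (e1 : m = m') (e2 : m' = m'') (e3 : n = n') (e4 : n' = n'') (f : H m n) :
  castm e2 e4 (castm e1 e3 f) = castm (etrans e1 e2) (etrans e3 e4) f.
Proof. by case: _ / e2; case: _ / e4; case: _ / e1; case: _ / e3. Qed.

Lemma castm_irr (H : nat -> nat -> Type) m m' n n'
  (e1 e2 : m = m') (e3 e4 : n = n') (f : H m n) :
  castm e1 e3 f = castm e2 e4 f.
Proof. by rewrite (eq_irrelevance e1 e2) (eq_irrelevance e3 e4). Qed.

Lemma castm_id (H : nat -> nat -> Type) m n (e1 : m = m) (e2 : n = n)
  (f : H m n) : castm e1 e2 f = f.
Proof. by rewrite (castm_irr e1 erefl e2 erefl). Qed.

Lemma castm_eqv m m' n n' (e1 : m = m') (e2 : n = n') (f g : A m n) :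
  eqv f g -> eqv (castm e1 e2 f) (castm e1 e2 g).
Proof. by case: _ / e1; case: _ / e2. Qed.

Lemma castm_idm m n (e1 e2 : m = n) : castm e1 e2 (idm m : A m m) = idm n.
Proof. by case: _ / e1 e2 => e2; rewrite castm_id. Qed.

Lemma castm_pcomp m m' n n' p p' (e1 : m = m') (e2 : n = n') (e3 : p = p')
  (f : A m n) (g : A n p) :
  castm e1 e3 (pcomp f g) = pcomp (castm e1 e2 f) (castm e2 e3 g).
Proof. by case: _ / e1; case: _ / e2; case: _ / e3. Qed.

Lemma castm_tens m m' n n' p p' q q' (e1 : m = m') (e2 : n = n')
  (e3 : p = p') (e4 : q = q') (e5 : m + p = m' + p') (e6 : n + q = n' + q')
  (f : A m n) (g : A p q) :
  tens (castm e1 e2 f) (castm e3 e4 g) = castm e5 e6 (tens f g).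
Proof.
case: _ / e1 e5 => e5; case: _ / e2 e6 => e6; case: _ / e3 e5 => e5.
by case: _ / e4 e6 => e6; rewrite !castm_id.
Qed.

Lemma castm_swap m m' n n' (e1 : m = m') (e2 : n = n')
  (e3 : m + n = m' + n') (e4 : n + m = n' + m') :
  castm e3 e4 (swap m n : A _ _) = swap m' n'.
Proof.
by case: _ / e1 e3 e4 => e3 e4; case: _ / e2 e3 e4 => e3 e4; rewrite castm_id.
Qed.

Lemma castm_fhom (B : propcat) (F : forall m n, A m n -> B m n) m m' n n'
  (e1 : m = m') (e2 : n = n') (f : A m n) :
  F m' n' (castm e1 e2 f) = castm e1 e2 (F m n f).
Proof. by case: _ / e1; case: _ / e2. Qed.

Lemma castm_smf (B : propcat) (d : nat -> nat)
  (F : forall m n, A m n -> B (d m) (d n)) m m' n n'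
  (e1 : m = m') (e2 : n = n') (e3 : d m = d m') (e4 : d n = d n') (f : A m n) :
  F m' n' (castm e1 e2 f) = castm e3 e4 (F m n f).
Proof.
by case: _ / e1 e3 => e3; case: _ / e2 e4 => e4; rewrite !castm_id.
Qed.

End Cast.

Section SMFComp.
Variables A B C : propcat.

Definition smf_of_pm (F : prop_morph A B) : smfunctor A B :=
  @SMFunctor A B id erefl (fun _ _ => erefl) (@pm _ _ F) (@pm_eqv _ _ F)
    (@pm_id _ _ F) (@pm_pcomp _ _ F) (@pm_tens _ _ F) (@pm_swap _ _ F).

Variables (F : smfunctor A B) (G : smfunctor B C).

Definition smf_comp_obj n := fobj G (fobj F n).
Definition smf_comp_hom m n (f : A m n) : C (smf_comp_obj m) (smf_comp_obj n) := fhom G (fhom F f).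

Lemma smf_comp_obj0 : smf_comp_obj 0 = 0.
Proof. by rewrite /smf_comp_obj fobj0 fobj0. Qed.

Lemma smf_comp_objD m n : smf_comp_obj (m + n) = smf_comp_obj m + smf_comp_obj n.
Proof. by rewrite /smf_comp_obj fobjD fobjD. Qed.

Lemma smf_comp_eqv m n (f g : A m n) : eqv f g -> eqv (smf_comp_hom f) (smf_comp_hom g).
Proof. by move=> fg; do 2!apply: fhom_eqv. Qed.

Lemma smf_comp_id n : eqv (smf_comp_hom (idm n)) (idm (smf_comp_obj n)).
Proof. by apply: eqv_trans (fhom_id G _); apply/fhom_eqv/fhom_id. Qed.

Lemma smf_comp_pcomp m n p (f : A m n) (g : A n p) :
  eqv (smf_comp_hom (pcomp f g)) (pcomp (smf_comp_hom f) (smf_comp_hom g)).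
Proof.
by apply: eqv_trans (fhom_pcomp G _ _); apply/fhom_eqv/fhom_pcomp.
Qed.

Lemma smf_comp_tens m n m' n' (f : A m n) (g : A m' n') :
  eqv (smf_comp_hom (tens f g))
      (castm (esym (smf_comp_objD m m')) (esym (smf_comp_objD n n')) (tens (smf_comp_hom f) (smf_comp_hom g))).
Proof.
have := fhom_eqv G (fhom_tens F f g).
rewrite (castm_smf (@fhom _ _ G) _ _ (congr1 (fobj G) (esym (fobjD F m m')))
  (congr1 (fobj G) (esym (fobjD F n n')))).
move/eqv_trans; apply.
have := castm_eqv (congr1 (fobj G) (esym (fobjD F m m')))
  (congr1 (fobj G) (esym (fobjD F n n'))) (fhom_tens G (fhom F f) (fhom F g)).
by move/eqv_trans; apply; rewrite castm_comp; rewrite (castm_irr _ (esym (smf_comp_objD m m')) _ (esym (smf_comp_objD n n'))); apply: eqv_refl.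
Qed.

Lemma smf_comp_swap m n :
  eqv (smf_comp_hom (swap m n))
      (castm (esym (smf_comp_objD m n)) (esym (smf_comp_objD n m)) (swap (smf_comp_obj m) (smf_comp_obj n))).
Proof.
have := fhom_eqv G (fhom_swap F m n).
rewrite (castm_smf (@fhom _ _ G) _ _ (congr1 (fobj G) (esym (fobjD F m n)))
  (congr1 (fobj G) (esym (fobjD F n m)))).
move/eqv_trans; apply.
have := castm_eqv (congr1 (fobj G) (esym (fobjD F m n)))
  (congr1 (fobj G) (esym (fobjD F n m))) (fhom_swap G (fobj F m) (fobj F n)).
by move/eqv_trans; apply; rewrite castm_comp; rewrite (castm_irr _ (esym (smf_comp_objD m n)) _ (esym (smf_comp_objD n m))); apply: eqv_refl.
Qed.

(* Diagrammatic order: first [F], then [G]. *)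
Definition smf_comp : smfunctor A C :=
  SMFunctor smf_comp_obj0 smf_comp_eqv smf_comp_id smf_comp_pcomp smf_comp_tens smf_comp_swap.

End SMFComp.

Definition signature := nat -> nat -> Type.

Inductive term (S : signature) : nat -> nat -> Type :=
| TGen m n of S m n : term S m n
| TId n : term S n n
| TComp m n p of term S m n & term S n p : term S m p
| TTens m n m' n' of term S m n & term S m' n' : term S (m + m') (n + n')
| TSwap m n : term S (m + n) (n + m).

Arguments TGen {S m n}.
Arguments TId {S} n.
Arguments TSwap {S} m n.

(* The least congruence containing the relations [E] and the laws of strict
   symmetric monoidal categories. *)
Inductive term_eq (S : signature)
    (E : forall m n, term S m n -> term S m n -> Prop) :
    forall m n, term S m n -> term S m n -> Prop :=
| TE_rel m n (f g : term S m n) : E m n f g -> term_eq E f g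
| TE_refl m n (f : term S m n) : term_eq E f f
| TE_sym m n (f g : term S m n) : term_eq E f g -> term_eq E g f
| TE_trans m n (f g h : term S m n) :
    term_eq E f g -> term_eq E g h -> term_eq E f h
| TE_comp m n p (f f' : term S m n) (g g' : term S n p) :
    term_eq E f f' -> term_eq E g g' -> term_eq E (TComp f g) (TComp f' g')
| TE_tens m n m' n' (f f' : term S m n) (g g' : term S m' n') :
    term_eq E f f' -> term_eq E g g' -> term_eq E (TTens f g) (TTens f' g')
| TE_compA m n p q (f : term S m n) (g : term S n p) (h : term S p q) :
    term_eq E (TComp f (TComp g h)) (TComp (TComp f g) h)
| TE_comp1l m n (f : term S m n) : term_eq E (TComp (TId m) f) f
| TE_comp1r m n (f : term S m n) : term_eq E (TComp f (TId n)) f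
| TE_tens_id m n : term_eq E (TTens (TId m) (TId n)) (TId (m + n))
| TE_tens_comp m n p m' n' p' (f : term S m n) (g : term S n p)
    (f' : term S m' n') (g' : term S n' p') :
    term_eq E (TTens (TComp f g) (TComp f' g'))
              (TComp (TTens f f') (TTens g g'))
| TE_tensA m n m' n' m'' n'' (f : term S m n) (g : term S m' n')
    (h : term S m'' n'') :
    term_eq E (castm (addnA m m' m'') (addnA n n' n'') (TTens f (TTens g h)))
              (TTens (TTens f g) h)
| TE_tens0l m n (f : term S m n) : term_eq E (TTens (TId 0) f) f
| TE_tens0r m n (f : term S m n) :
    term_eq E (castm (addn0 m) (addn0 n) (TTens f (TId 0))) f
| TE_swap_nat m n m' n' (f : term S m n) (g : term S m' n') :
    term_eq E (TComp (TTens f g) (TSwap n n')) (TComp (TSwap m m') (TTens g f))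
| TE_swapK m n : term_eq E (TComp (TSwap m n) (TSwap n m)) (TId (m + n))
| TE_swap_hex m n p :
    term_eq E (TSwap m (n + p))
      (castm (esym (addnA m n p)) (addnA n p m)
         (TComp
            (castm erefl (esym (addnA n m p)) (TTens (TSwap m n) (TId p)))
            (TTens (TId n) (TSwap m p)))).

Definition presented (S : signature)
    (E : forall m n, term S m n -> term S m n -> Prop) : propcat :=
  @PropCat (term S) (@term_eq S E) (@TId S) (@TComp S) (@TTens S) (@TSwap S)
    (@TE_refl S E) (@TE_sym S E) (@TE_trans S E) (@TE_comp S E) (@TE_tens S E)
    (@TE_compA S E) (@TE_comp1l S E) (@TE_comp1r S E) (@TE_tens_id S E)
    (@TE_tens_comp S E) (@TE_tensA S E) (@TE_tens0l S E) (@TE_tens0r S E)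
    (@TE_swap_nat S E) (@TE_swapK S E) (@TE_swap_hex S E).

Section PresentedLift.
Variables (S : signature) (E : forall m n, term S m n -> term S m n -> Prop).
Variables (B : propcat) (g : forall m n, S m n -> B m n).

Fixpoint term_eval m n (t : term S m n) : B m n :=
  match t in term _ m n return B m n with
  | TGen _ _ s => g s
  | TId n => idm n
  | TComp _ _ _ u v => pcomp (term_eval u) (term_eval v)
  | TTens _ _ _ _ u v => tens (term_eval u) (term_eval v)
  | TSwap m n => swap m n
  end.

Lemma term_eval_cast m m' n n' (e1 : m = m') (e2 : n = n') (t : term S m n) :
  term_eval (castm e1 e2 t) = castm e1 e2 (term_eval t).
Proof. by case: _ / e1; case: _ / e2. Qed.

Hypothesis gE : forall m n (t u : term S m n),
  E t u -> eqv (term_eval t) (term_eval u).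

Lemma term_eval_eqv m n (t u : term S m n) :
  term_eq E t u -> eqv (term_eval t) (term_eval u).
Proof.
elim=> {m n t u}; rewrite /=; intros; rewrite ?term_eval_cast /=
  ?term_eval_cast /=.
- exact: gE.
- exact: eqv_refl.
- exact: eqv_sym.
- by apply: eqv_trans; eassumption.
- exact: pcomp_eqv.
- exact: tens_eqv.
- exact: pcompA.
- exact: pcomp1l.
- exact: pcomp1r.
- exact: tens_id.
- exact: tens_pcomp.
- exact: tensA.
- exact: tens0l.
- exact: tens0r.
- exact: swap_nat.
- exact: swapK.
- exact: swap_hex.
Qed.

Definition presented_lift : prop_morph (presented E) B :=
  @PropMorph (presented E) B term_eval term_eval_eqv
    (fun _ => eqv_refl _) (fun _ _ _ _ _ => eqv_refl _)
    (fun _ _ _ _ _ _ => eqv_refl _) (fun _ _ => eqv_refl _).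

Lemma presented_lift_unique (F : prop_morph (presented E) B) :
  (forall m n (s : S m n), eqv (F m n (TGen s)) (g s)) ->
  forall m n (t : term S m n), eqv (F m n t) (presented_lift m n t).
Proof.
move=> Fg m n; elim=> {m n} //=.
- by move=> n; apply: (pm_id F).
- move=> m n p f IHf h IHh; apply: eqv_trans (pm_pcomp F _ _) _.
  exact: pcomp_eqv.
- move=> m n m' n' f IHf h IHh; apply: eqv_trans (pm_tens F _ _) _.
  exact: tens_eqv.
- by move=> m n; apply: (pm_swap F).
Qed.

End PresentedLift.

Section Free.
Variable S : signature.

Definition free_prop : propcat :=
  @presented S (fun _ _ _ _ => False).

Definition free_lift (B : propcat) (g : forall m n, S m n -> B m n) :
    prop_morph free_prop B :=
  @presented_lift S _ B g (fun _ _ _ _ => False_ind _).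

End Free.

Section Coproduct.
Variables A B : propcat.

Definition coprod_sig : signature := fun m n => (A m n + B m n)%type.
Definition sig_inl m n (f : A m n) : coprod_sig m n := inl f.
Definition sig_inr m n (f : B m n) : coprod_sig m n := inr f.

(* The relations making [i] a morphism of props. *)
Inductive morph_rel (S : signature) (D : propcat)
    (i : forall m n, D m n -> S m n) :
    forall m n, term S m n -> term S m n -> Prop :=
| MR_eqv m n (f g : D m n) :
    eqv f g -> morph_rel i (TGen (i m n f)) (TGen (i m n g))
| MR_id n : morph_rel i (TGen (i n n (idm n))) (TId n)
| MR_pcomp m n p (f : D m n) (g : D n p) :
    morph_rel i (TGen (i m p (pcomp f g)))
                (TComp (TGen (i m n f)) (TGen (i n p g)))
| MR_tens m n m' n' (f : D m n) (g : D m' n') :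
    morph_rel i (TGen (i _ _ (tens f g)))
                (TTens (TGen (i m n f)) (TGen (i m' n' g)))
| MR_swap m n : morph_rel i (TGen (i _ _ (swap m n))) (TSwap m n).

Definition coprod : propcat :=
  @presented coprod_sig (fun m n t u =>
    morph_rel sig_inl t u \/ morph_rel sig_inr t u).

Definition coprod_inl : prop_morph A coprod :=
  @PropMorph A coprod (fun m n f => TGen (sig_inl f))
    (fun _ _ _ _ fg => TE_rel (or_introl (MR_eqv sig_inl fg)))
    (fun _ => TE_rel (or_introl (MR_id sig_inl _)))
    (fun _ _ _ _ _ => TE_rel (or_introl (MR_pcomp sig_inl _ _)))
    (fun _ _ _ _ _ _ => TE_rel (or_introl (MR_tens sig_inl _ _)))
    (fun _ _ => TE_rel (or_introl (MR_swap sig_inl _ _))).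

Definition coprod_inr : prop_morph B coprod :=
  @PropMorph B coprod (fun m n f => TGen (sig_inr f))
    (fun _ _ _ _ fg => TE_rel (or_intror (MR_eqv sig_inr fg)))
    (fun _ => TE_rel (or_intror (MR_id sig_inr _)))
    (fun _ _ _ _ _ => TE_rel (or_intror (MR_pcomp sig_inr _ _)))
    (fun _ _ _ _ _ _ => TE_rel (or_intror (MR_tens sig_inr _ _)))
    (fun _ _ => TE_rel (or_intror (MR_swap sig_inr _ _))).

Section Copair.
Variables (C : propcat) (F : prop_morph A C) (G : prop_morph B C).

Definition copair_gen m n (s : coprod_sig m n) : C m n :=
  match s with inl f => pm F f | inr f => pm G f end.

Lemma copair_rel m n (t u : term coprod_sig m n) :
  morph_rel sig_inl t u \/ morph_rel sig_inr t u ->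
  eqv (term_eval copair_gen t) (term_eval copair_gen u).
Proof.
case; case=> {m n t u} /=; intros;
  by [apply: pm_eqv | apply: pm_id | apply: pm_pcomp | apply: pm_tens
     | apply: pm_swap].
Qed.

Definition copair : prop_morph coprod C := presented_lift copair_rel.

Lemma copair_inl m n (f : A m n) : copair _ _ (coprod_inl _ _ f) = F m n f.
Proof. by []. Qed.

Lemma copair_inr m n (f : B m n) : copair _ _ (coprod_inr _ _ f) = G m n f.
Proof. by []. Qed.

Lemma copair_unique (H : prop_morph coprod C) :
  (forall m n (f : A m n), eqv (H m n (coprod_inl m n f)) (F m n f)) ->
  (forall m n (f : B m n), eqv (H m n (coprod_inr m n f)) (G m n f)) ->
  forall m n (t : coprod m n), eqv (H m n t) (copair m n t).
Proof.
by move=> HF HG m n t; apply: presented_lift_unique => p q [] f; [apply: HF | apply: HG].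
Qed.

End Copair.
End Coproduct.

Local Open Scope ring_scope.

Definition lin_closed (K : fieldType) (V : lmodType K) (P : V -> Prop) :=
  P 0 /\ forall (a : K) u v, P u -> P v -> P (a *: u + v).

Section Subspace.
Variables (K : fieldType) (V : vectType K) (P : V -> Prop).

Lemma subspace_ex : lin_closed P -> exists U : {vspace V}, forall v, v \in U <-> P v.
Proof.
move=> [P0 PD].
pose Q n := `[< exists U : {vspace V}, (forall v, v \in U -> P v) /\ \dim U = n >].
have Q0 : exists n, Q n.
  exists 0%N; apply/asboolP; exists 0%VS; split; last exact: dimv0.
  by move=> v; rewrite memv0 => /eqP->.
have Qle n : Q n -> (n <= \dim {:V})%N.
  by move=> /asboolP[U [_ <-]]; apply/dimvS/subvf.
case: (ex_maxnP Q0 Qle) => n /asboolP[U [UP dimU]] nmax; exists U => v.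
split; first exact: UP.
move=> Pv; apply: contraT => vU.
have /nmax : Q (\dim (U + <[v]>)).
  apply/asboolP; exists (U + <[v]>)%VS; split=> // w.
  case/memv_addP => u uU [_ /vlineP[a ->] ->].
  by rewrite addrC; apply: PD => //; apply: UP.
rewrite -dimU leqNgt => /negP; case.
rewrite (ltn_leqif (dimv_leqif_sup (addvSl U <[v]>))).
apply: contra vU => /subvP; apply.
by rewrite -{1}[v]add0r; apply: memv_add; [apply: mem0v | apply: memv_line].
Qed.

Definition subspace (H : lin_closed P) : {vspace V} := projT1 (cid (subspace_ex H)).

Lemma subspaceP (H : lin_closed P) v : v \in subspace H <-> P v.
Proof. by rewrite /subspace; case: cid. Qed.

End Subspace.

Definition linrel (k : fieldType) (m n : nat) :=
  {vspace ('rV[k]_m * 'rV[k]_n)%type}.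

Lemma linrelP (k : fieldType) m n (R S : linrel k m n) :
  (forall x y, (x, y) \in R <-> (x, y) \in S) -> R = S.
Proof.
move=> RS; apply/vspaceP => -[x y].
by apply/idP/idP => /RS.
Qed.

Section FinRel.
Variable k : fieldType.

Lemma linrel_lin m n (R : linrel k m n) a x y x' y' :
  (x, y) \in R -> (x', y') \in R -> (a *: x + x', a *: y + y') \in R.
Proof.
by move=> Rxy Rxy'; rewrite -[(_, _)]/(a *: (x, y) + (x', y')) memvD ?memvZ.
Qed.

Lemma linrel0 m n (R : linrel k m n) : (0, 0) \in R.
Proof. exact: (mem0v R). Qed.

Lemma id_rel_lin n :
  lin_closed (fun u : 'rV[k]_n * 'rV[k]_n => u.1 = u.2).
Proof. by split=> [//|a [x y] [x' y'] /= -> ->]. Qed.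

Lemma comp_rel_lin m n p (R : linrel k m n) (S : linrel k n p) :
  lin_closed (fun u : 'rV[k]_m * 'rV[k]_p =>
    exists y, (u.1, y) \in R /\ (y, u.2) \in S).
Proof.
split=> [|a [x z] [x' z'] /= [y [Rxy Syz]] [y' [Rxy' Syz']]].
  by exists 0; split; apply: linrel0.
by exists (a *: y + y'); split; apply: linrel_lin.
Qed.

Lemma tens_rel_lin m n m' n' (R : linrel k m n) (S : linrel k m' n') :
  lin_closed (fun u : 'rV[k]_(m + m') * 'rV[k]_(n + n') =>
    (lsubmx u.1, lsubmx u.2) \in R /\ (rsubmx u.1, rsubmx u.2) \in S).
Proof.
split=> [|a [x y] [x' y'] /= [Rxy Sxy] [Rxy' Sxy']].
  by rewrite /= !linear0; split; apply: linrel0.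
by rewrite !linearP; split; apply: linrel_lin.
Qed.

Lemma swap_rel_lin m n :
  lin_closed (fun u : 'rV[k]_(m + n) * 'rV[k]_(n + m) =>
    lsubmx u.1 = rsubmx u.2 /\ rsubmx u.1 = lsubmx u.2).
Proof.
split=> [|a [x y] [x' y'] /= [e1 e2] [e1' e2']].
  by rewrite /= !linear0.
by rewrite !linearP /= e1 e2 e1' e2'.
Qed.

Definition id_rel n : linrel k n n := subspace (@id_rel_lin n).
Definition comp_rel m n p (R : linrel k m n) (S : linrel k n p) : linrel k m p :=
  subspace (comp_rel_lin R S).
Definition tens_rel m n m' n' (R : linrel k m n) (S : linrel k m' n') :
  linrel k (m + m') (n + n') := subspace (tens_rel_lin R S).
Definition swap_rel m n : linrel k (m + n) (n + m) := subspace (@swap_rel_lin m n).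

Lemma id_relP n x y : (x, y) \in id_rel n <-> x = y.
Proof. exact: subspaceP. Qed.

Lemma comp_relP m n p (R : linrel k m n) (S : linrel k n p) x z :
  (x, z) \in comp_rel R S <-> exists y, (x, y) \in R /\ (y, z) \in S.
Proof. exact: subspaceP. Qed.

Lemma tens_relP m n m' n' (R : linrel k m n) (S : linrel k m' n') x y :
  (x, y) \in tens_rel R S <->
  (lsubmx x, lsubmx y) \in R /\ (rsubmx x, rsubmx y) \in S.
Proof. exact: subspaceP. Qed.

Lemma swap_relP m n x y :
  (x, y) \in swap_rel m n <-> lsubmx x = rsubmx y /\ rsubmx x = lsubmx y.
Proof. exact: subspaceP. Qed.

Lemma cast_relP m m' n n' (em : m = m') (en : n = n') (R : linrel k m n) x y :
  (x, y) \in castm em en R <->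
  (castmx (erefl, esym em) x, castmx (erefl, esym en) y) \in R.
Proof. by case: _ / em x; case: _ / en y => y x; rewrite !castmx_id. Qed.

Lemma row_splitP m n (x y : 'rV[k]_(m + n)) :
  lsubmx x = lsubmx y -> rsubmx x = rsubmx y -> x = y.
Proof. by move=> e1 e2; rewrite -[x]hsubmxK -[y]hsubmxK e1 e2. Qed.

Lemma comp_relA m n p q (R : linrel k m n) (S : linrel k n p) (T : linrel k p q) :
  comp_rel R (comp_rel S T) = comp_rel (comp_rel R S) T.
Proof.
apply: linrelP => x y; rewrite !comp_relP; split.
  move=> [u [Rxu /comp_relP[v [Suv Tvy]]]]; exists v; split=> //.
  by apply/comp_relP; exists u.
move=> [v [/comp_relP[u [Rxu Suv]] Tvy]]; exists u; split=> //.
by apply/comp_relP; exists v.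
Qed.

Lemma comp_rel1l m n (R : linrel k m n) : comp_rel (id_rel m) R = R.
Proof.
apply: linrelP => x y; rewrite comp_relP; split=> [[u [/id_relP-> //]]|Rxy].
by exists x; split=> //; apply/id_relP.
Qed.

Lemma comp_rel1r m n (R : linrel k m n) : comp_rel R (id_rel n) = R.
Proof.
apply: linrelP => x y; rewrite comp_relP; split=> [[u [? /id_relP<- //]]|Rxy].
by exists y; split=> //; apply/id_relP.
Qed.

Lemma tens_rel_id m n : tens_rel (id_rel m) (id_rel n) = id_rel (m + n).
Proof.
apply: linrelP => x y; rewrite tens_relP !id_relP.
by split=> [[]|-> //]; apply: row_splitP.
Qed.

Lemma tens_rel_comp m n p m' n' p' (f : linrel k m n) (g : linrel k n p)
  (f' : linrel k m' n') (g' : linrel k n' p') :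
  tens_rel (comp_rel f g) (comp_rel f' g') =
  comp_rel (tens_rel f f') (tens_rel g g').
Proof.
apply: linrelP => x y; rewrite tens_relP !comp_relP; split.
  move=> [[u [fu gu]] [v [fv gv]]]; exists (row_mx u v).
  by rewrite !tens_relP row_mxKl row_mxKr.
move=> [u [/tens_relP[fu fv] /tens_relP[gu gv]]].
by split; [exists (lsubmx u) | exists (rsubmx u)].
Qed.

Lemma tens_relA m n m' n' m'' n'' (f : linrel k m n) (g : linrel k m' n')
  (h : linrel k m'' n'') :
  castm (addnA m m' m'') (addnA n n' n'') (tens_rel f (tens_rel g h)) =
  tens_rel (tens_rel f g) h.
Proof.
have c1 p q r (x : 'rV[k]_(p + q + r)) :
    lsubmx (castmx (erefl, esym (addnA p q r)) x) = lsubmx (lsubmx x).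
  by apply/rowP=> i; rewrite !mxE castmxE; congr (x _ _); apply: val_inj.
have c2 p q r (x : 'rV[k]_(p + q + r)) :
    lsubmx (rsubmx (castmx (erefl, esym (addnA p q r)) x)) = rsubmx (lsubmx x).
  by apply/rowP=> i; rewrite !mxE castmxE; congr (x _ _); apply: val_inj.
have c3 p q r (x : 'rV[k]_(p + q + r)) :
    rsubmx (rsubmx (castmx (erefl, esym (addnA p q r)) x)) = rsubmx x.
  apply/rowP=> i; rewrite !mxE castmxE; congr (x _ _); apply: val_inj.
    by [].
  by rewrite /= addnA.
by apply: linrelP => x y; rewrite cast_relP !tens_relP !c1 !c2 !c3; tauto.
Qed.

Lemma row0 (x y : 'rV[k]_0) : x = y.
Proof. by apply/rowP; case. Qed.

Lemma tens_rel0l m n (f : linrel k m n) : tens_rel (id_rel 0) f = f.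
Proof.
have c p (x : 'rV[k]_(0 + p)) : rsubmx x = x.
  by apply/rowP=> i; rewrite mxE; congr (x _ _); apply: val_inj.
apply: linrelP => x y; rewrite tens_relP id_relP !c.
by split=> [[]|? ] //; split=> //; apply: row0.
Qed.

Lemma tens_rel0r m n (f : linrel k m n) :
  castm (addn0 m) (addn0 n) (tens_rel f (id_rel 0)) = f.
Proof.
have c p (x : 'rV[k]_p) : lsubmx (castmx (erefl, esym (addn0 p)) x) = x.
  apply/rowP=> i; rewrite !mxE castmxE.
  by congr (x _ _); [rewrite ord1 | apply: val_inj].
apply: linrelP => x y; rewrite cast_relP tens_relP id_relP !c.
by split=> [[]|? ] //; split=> //; apply: row0.
Qed.

Lemma swap_rel_nat m n m' n' (f : linrel k m n) (g : linrel k m' n') :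
  comp_rel (tens_rel f g) (swap_rel n n') = comp_rel (swap_rel m m') (tens_rel g f).
Proof.
apply: linrelP => x y; rewrite !comp_relP; split.
  move=> [u [/tens_relP[fu gu] /swap_relP[e1 e2]]].
  exists (row_mx (rsubmx x) (lsubmx x)).
  by rewrite swap_relP tens_relP row_mxKl row_mxKr -e1 -e2.
move=> [u [/swap_relP[e1 e2] /tens_relP[gu fu]]].
exists (row_mx (rsubmx y) (lsubmx y)).
by rewrite swap_relP tens_relP row_mxKl row_mxKr e1 e2.
Qed.

Lemma swap_relK m n : comp_rel (swap_rel m n) (swap_rel n m) = id_rel (m + n).
Proof.
apply: linrelP => x y; rewrite comp_relP id_relP; split.
  move=> [u [/swap_relP[e1 e2] /swap_relP[e3 e4]]].
  by apply: row_splitP; rewrite ?e1 ?e2.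
move=> <-; exists (row_mx (rsubmx x) (lsubmx x)).
by rewrite !swap_relP row_mxKl row_mxKr.
Qed.

Lemma swap_rel_hex m n p :
  swap_rel m (n + p) =
  castm (esym (addnA m n p)) (addnA n p m)
    (comp_rel
      (castm erefl (esym (addnA n m p)) (tens_rel (swap_rel m n) (id_rel p)))
      (tens_rel (id_rel n) (swap_rel m p))).
Proof.
have a1 (x : 'rV[k]_(m + (n + p))) :
   lsubmx (lsubmx (castmx (erefl, esym (esym (addnA m n p))) x)) = lsubmx x.
  by apply/rowP=> i; rewrite !mxE castmxE; congr (x _ _); apply: val_inj.
have a2 (x : 'rV[k]_(m + (n + p))) :
   rsubmx (lsubmx (castmx (erefl, esym (esym (addnA m n p))) x)) = lsubmx (rsubmx x).
  by apply/rowP=> i; rewrite !mxE castmxE; congr (x _ _); apply: val_inj.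
have a3 (x : 'rV[k]_(m + (n + p))) :
   rsubmx (castmx (erefl, esym (esym (addnA m n p))) x) = rsubmx (rsubmx x).
  apply/rowP=> i; rewrite !mxE castmxE; congr (x _ _); apply: val_inj.
    by [].
  by rewrite /= addnA.
have b1 (y : 'rV[k]_(n + (m + p))) :
   lsubmx (lsubmx (castmx (erefl, esym (esym (addnA n m p))) y)) = lsubmx y.
  by apply/rowP=> i; rewrite !mxE castmxE; congr (y _ _); apply: val_inj.
have b2 (x : 'rV[k]_(n + (m + p))) :
   rsubmx (lsubmx (castmx (erefl, esym (esym (addnA n m p))) x)) = lsubmx (rsubmx x).
  by apply/rowP=> i; rewrite !mxE castmxE; congr (x _ _); apply: val_inj.
have b3 (x : 'rV[k]_(n + (m + p))) :
   rsubmx (castmx (erefl, esym (esym (addnA n m p))) x) = rsubmx (rsubmx x).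
  apply/rowP=> i; rewrite !mxE castmxE; congr (x _ _); apply: val_inj.
    by [].
  by rewrite /= addnA.
have d1 (x : 'rV[k]_((n + p) + m)) :
   lsubmx (castmx (erefl, esym (addnA n p m)) x) = lsubmx (lsubmx x).
  by apply/rowP=> i; rewrite !mxE castmxE; congr (x _ _); apply: val_inj.
have d2 (x : 'rV[k]_((n + p) + m)) :
   lsubmx (rsubmx (castmx (erefl, esym (addnA n p m)) x)) = rsubmx (lsubmx x).
  by apply/rowP=> i; rewrite !mxE castmxE; congr (x _ _); apply: val_inj.
have d3 (x : 'rV[k]_((n + p) + m)) :
   rsubmx (rsubmx (castmx (erefl, esym (addnA n p m)) x)) = rsubmx x.
  apply/rowP=> i; rewrite !mxE castmxE; congr (x _ _); apply: val_inj.
    by [].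
  by rewrite /= addnA.
apply: linrelP => x y; rewrite cast_relP swap_relP comp_relP; split.
  move=> [e1 e2].
  exists (row_mx (lsubmx (rsubmx x)) (row_mx (lsubmx x) (rsubmx (rsubmx x)))).
  rewrite cast_relP !tens_relP !swap_relP !id_relP castmx_id a1 a2 a3 b1 b2 b3.
  by rewrite !(row_mxKl, row_mxKr) d1 d2 d3 e1 e2.
move=> [u [/cast_relP/tens_relP[/swap_relP[e1 e2] /id_relP e3]]].
case/tens_relP => /id_relP e4 /swap_relP[e5 e6].
move: e1 e2 e3 e4 e5 e6.
rewrite castmx_id a1 a2 a3 b1 b2 b3 d1 d2 d3 => e1 e2 e3 e4 e5 e6.
split; first by rewrite e1 e5.
by apply: row_splitP; [rewrite e2 e4 | rewrite e3 e6].
Qed.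

(* Equality of morphisms is equality of subspaces. *)
Definition FinRel : propcat.
refine (@PropCat (linrel k) (fun _ _ => eq) id_rel comp_rel tens_rel swap_rel
  _ _ _ _ _ _ _ _ _ _ _ _ _ _ _ _).
- by [].
- by [].
- by move=> m n f g h -> ->.
- by move=> m n p f f' g g' -> ->.
- by move=> m n m' n' f f' g g' -> ->.
- exact: comp_relA.
- exact: comp_rel1l.
- exact: comp_rel1r.
- exact: tens_rel_id.
- exact: tens_rel_comp.
- exact: tens_relA.
- exact: tens_rel0l.
- exact: tens_rel0r.
- exact: swap_rel_nat.
- exact: swap_relK.
- exact: swap_rel_hex.
Defined.

End FinRel.

Record symplectic (k : fieldType) (V : vectType k) (omega : V -> V -> k) : Prop :=
  Symplectic {
    sympl_l : forall v, scalar (omega^~ v);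
    sympl_r : forall u, scalar (omega u);
    sympl_alt : forall u, omega u u = 0;
    sympl_nondeg : forall u, (forall v, omega u v = 0) -> u = 0
  }.

Definition isotropic (k : fieldType) (V : vectType k) (omega : V -> V -> k)
    (L : {vspace V}) : Prop :=
  forall u v, u \in L -> v \in L -> omega u v = 0.

Definition lagrangian (k : fieldType) (V : vectType k) (omega : V -> V -> k)
    (L : {vspace V}) : Prop :=
  isotropic omega L /\
  forall L' : {vspace V}, isotropic omega L' -> (L <= L')%VS -> L' = L.

(* The form of the conjugate of V plus V'. *)
Definition conj_sum (k : fieldType) (V V' : vectType k)
    (omega : V -> V -> k) (omega' : V' -> V' -> k) (u v : V * V') : k :=
  - omega u.1 v.1 + omega' u.2 v.2.

(* Vectors of (k (+) k)^n = k^(2n) list their coordinates in the order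
   phi_1, I_1, ..., phi_n, I_n. *)
Lemma pot_subproof n (i : 'I_n) : (i.*2 < n.*2)%N.
Proof. by rewrite ltn_double. Qed.

Lemma cur_subproof n (i : 'I_n) : (i.*2.+1 < n.*2)%N.
Proof. by rewrite ltn_Sdouble. Qed.

Definition pot (k : fieldType) n (x : 'rV[k]_(n.*2)) (i : 'I_n) : k :=
  x 0 (Ordinal (pot_subproof i)).
Definition cur (k : fieldType) n (x : 'rV[k]_(n.*2)) (i : 'I_n) : k :=
  x 0 (Ordinal (cur_subproof i)).

Definition std_form (k : fieldType) n (x y : 'rV[k]_(n.*2)) : k :=
  \sum_(i < n) (pot x i * cur y i - pot y i * cur x i).

Definition lagrel_form (k : fieldType) m n :=
  conj_sum (@std_form k m) (@std_form k n).

Section Symplectic.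
Variable k : fieldType.

Lemma fredholm (C T : finType) (M : C -> T -> k) (c : T -> k) :
  (forall x : T -> k, (forall j, \sum_t M j t * x t = 0) ->
     \sum_t c t * x t = 0) ->
  exists y : C -> k, forall t, c t = \sum_j y j * M j t.
Proof.
move=> H.
pose A : 'M[k]_(#|C|, #|T|) := \matrix_(i, j) M (enum_val i) (enum_val j).
pose v : 'rV[k]_#|T| := \row_j c (enum_val j).
have /submxP[D vD] : (v <= A)%MS.
  rewrite submxE; apply/eqP/rowP => l; rewrite !mxE.
  have E (f : T -> k) : \sum_t f t = \sum_(i < #|T|) f (enum_val i).
    by rewrite (reindex (@enum_val T T)) //; apply: onW_bij; apply: enum_val_bij.
  transitivity (\sum_t c t * cokermx A (enum_rank t) l).
    by rewrite E; apply: eq_bigr => i _; rewrite !mxE enum_valK.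
  apply: H => j; rewrite E.
  have := congr1 (fun B : 'M_(_, _) => B (enum_rank j) l) (mulmx_coker A).
  rewrite !mxE => {2}<-; apply: eq_bigr => i _.
  by rewrite !mxE enum_rankK enum_valK.
exists (fun j => D 0 (enum_rank j)) => t.
have := congr1 (fun B : 'rV_ _ => B 0 (enum_rank t)) vD.
rewrite !mxE enum_rankK => ->.
rewrite [RHS](reindex (@enum_val C C)) /=; last first.
  by apply: onW_bij; apply: enum_val_bij.
by apply: eq_bigr => i _; rewrite !mxE enum_rankK enum_valK.
Qed.

Section Forms.
Variables (V : vectType k) (omega : V -> V -> k) (sO : symplectic omega).

Lemma sympl_sym u v : omega u v = - omega v u.
Proof.
have Dl x y z : omega (x + y) z = omega x z + omega y z.
  by have := sympl_l sO z 1 x y; rewrite scale1r mul1r.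
have Dr x y z : omega x (y + z) = omega x y + omega x z.
  by have := sympl_r sO x 1 y z; rewrite scale1r mul1r.
have := sympl_alt sO (u + v).
rewrite Dl !Dr !(sympl_alt sO) add0r addr0.
by move/eqP; rewrite addr_eq0 => /eqP.
Qed.

Lemma sympl_0r u : omega u 0 = 0.
Proof.
by have := sympl_r sO u (-1) 0 0; rewrite scaler0 addr0 mulN1r addNr.
Qed.

Lemma sympl_0l u : omega 0 u = 0.
Proof. by rewrite sympl_sym sympl_0r oppr0. Qed.

Lemma sympl_Dr u v w : omega u (v + w) = omega u v + omega u w.
Proof. by have := sympl_r sO u 1 v w; rewrite scale1r mul1r. Qed.

Lemma sympl_Zr u a v : omega u (a *: v) = a * omega u v.
Proof. by have := sympl_r sO u a v 0; rewrite !addr0 sympl_0r addr0. Qed.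

Lemma sympl_Nr u v : omega u (- v) = - omega u v.
Proof. by rewrite -scaleN1r sympl_Zr mulN1r. Qed.

Lemma sympl_sumr (I : finType) u (a : I -> k) (v : I -> V) :
  omega u (\sum_i a i *: v i) = \sum_i a i * omega u (v i).
Proof.
elim/big_rec2: _ => [|i x y _ <-]; first exact: sympl_0r.
exact: sympl_r.
Qed.

Lemma sympl_suml (I : finType) u (a : I -> k) (v : I -> V) :
  omega (\sum_i a i *: v i) u = \sum_i a i * omega (v i) u.
Proof.
rewrite sympl_sym sympl_sumr -sumrN; apply: eq_bigr => i _.
by rewrite -mulrN -sympl_sym.
Qed.

Lemma lagrangianP (L : {vspace V}) :
  lagrangian omega L <->
  (forall v, v \in L <-> forall u, u \in L -> omega u v = 0).
Proof.
split=> [[iso maxL] v|H].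
  split=> [vL u uL|vperp]; first exact: iso.
  suff <- : (L + <[v]>)%VS = L.
    by rewrite -[v]add0r memv_add ?mem0v ?add0r ?memv_line.
  apply: maxL; last exact: addvSl.
  move=> _ _ /memv_addP[x xL [_ /vlineP[a ->] ->]]
    /memv_addP[y yL [_ /vlineP[b ->] ->]].
  rewrite [x + _]addrC (sympl_l sO) !sympl_Dr !sympl_Zr (iso x y) //.
  rewrite (vperp x) // (sympl_sym v y) (vperp y) // (sympl_alt sO).
  by rewrite !(oppr0, mulr0, addr0).
split=> [u v uL /H vL|L' iso' LL']; first exact: vL.
apply/eqP; rewrite eqEsubv LL' andbT; apply/subvP => v vL'.
by apply/H => u uL; apply: iso' => //; apply: (subvP LL').
Qed.

Lemma sympl_eq u v : (forall w, omega w u = omega w v) -> u = v.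
Proof.
move=> uv; apply/eqP; rewrite -subr_eq0; apply/eqP; apply: (sympl_nondeg sO) => w.
by rewrite sympl_sym sympl_Dr sympl_Nr uv subrr oppr0.
Qed.

End Forms.

Lemma conj_sum_symplectic (V V' : vectType k) (o : V -> V -> k) (o' : V' -> V' -> k) :
  symplectic o -> symplectic o' -> symplectic (conj_sum o o').
Proof.
move=> s s'; split.
- move=> v a u w; rewrite /conj_sum /= (sympl_l s) (sympl_l s').
  by rewrite mulrDr mulrN opprD addrACA.
- move=> v a u w; rewrite /conj_sum /= (sympl_r s) (sympl_r s').
  by rewrite mulrDr mulrN opprD addrACA.
- by move=> u; rewrite /conj_sum (sympl_alt s) (sympl_alt s') oppr0 addr0.
- move=> [u u'] H; congr (_, _).
    apply: (sympl_nondeg s) => v; have := H (v, 0).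
    by rewrite /conj_sum /= (sympl_0r s') addr0 => /eqP; rewrite oppr_eq0 => /eqP.
  apply: (sympl_nondeg s') => v; have := H (0, v).
  by rewrite /conj_sum /= (sympl_0r s) oppr0 add0r.
Qed.

Lemma potcur_ext n (x y : 'rV[k]_(n.*2)) :
  pot x =1 pot y -> cur x =1 cur y -> x = y.
Proof.
move=> ep ec; apply/rowP => i; have := odd_double_half i.
have hn : (i./2 < n)%N.
  by rewrite -ltn_double (leq_ltn_trans _ (ltn_ord i)) // -{2}(odd_double_half i) leq_addl.
case: (odd i) => /= ei.
  have := ec (Ordinal hn); rewrite /cur.
  by rewrite (_ : Ordinal _ = i) //; apply: val_inj.
have := ep (Ordinal hn); rewrite /pot.
by rewrite (_ : Ordinal _ = i) //; apply: val_inj.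
Qed.

Definition mkrow n (p c : 'I_n -> k) : 'rV[k]_(n.*2) :=
  \row_j (if insub (val j)./2 is Some i then if odd j then c i else p i else 0).

Lemma pot_mkrow n p c (i : 'I_n) : pot (mkrow p c) i = p i.
Proof.
rewrite /pot mxE /= doubleK odd_double.
by case: insubP => [j _ /val_inj -> //|]; rewrite ltn_ord.
Qed.

Lemma cur_mkrow n p c (i : 'I_n) : cur (mkrow p c) i = c i.
Proof.
rewrite /cur mxE /= uphalf_double odd_double /=.
by case: insubP => [j _ /val_inj -> //|]; rewrite ltn_ord.
Qed.

Lemma std_form_symplectic n : symplectic (@std_form k n).
Proof.
split.
- move=> v a u w; rewrite /std_form mulr_sumr -big_split; apply: eq_bigr => i _ /=.
  rewrite /pot /cur !mxE mulrDl [in X in _ - X]mulrDr mulrBr opprD addrACA.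
  by rewrite !mulrA [v _ _ * a]mulrC.
- move=> v a u w; rewrite /std_form mulr_sumr -big_split; apply: eq_bigr => i _ /=.
  rewrite /pot /cur !mxE mulrDl [in X in X - _]mulrDr mulrBr opprD addrACA.
  by rewrite !mulrA [v _ _ * a]mulrC.
- by move=> u; rewrite /std_form big1 // => i _; rewrite subrr.
- move=> u H; apply: potcur_ext => i.
    have := H (mkrow (fun _ => 0) (fun j => (j == i)%:R)).
    rewrite /std_form (bigD1 i) //= big1 => [|j ji];
      rewrite !pot_mkrow !cur_mkrow mul0r subr0.
      by rewrite eqxx mulr1 addr0 => ->; rewrite /pot mxE.
    by rewrite (negPf ji) mulr0.
  have := H (mkrow (fun j => (j == i)%:R) (fun _ => 0)).
  rewrite /std_form (bigD1 i) //= big1 => [|j ji];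
    rewrite !pot_mkrow !cur_mkrow mulr0 sub0r.
    rewrite eqxx mul1r addr0 => /eqP; rewrite oppr_eq0 => /eqP ->.
    by rewrite /cur mxE.
  by rewrite (negPf ji) mul0r oppr0.
Qed.

Lemma lagrel_form_symplectic m n : symplectic (@lagrel_form k m n).
Proof. by apply: conj_sum_symplectic; apply: std_form_symplectic. Qed.

Section Comp.
Variables (V1 V2 V3 : vectType k).
Variables (o1 : V1 -> V1 -> k) (o2 : V2 -> V2 -> k) (o3 : V3 -> V3 -> k).
Hypotheses (s1 : symplectic o1) (s2 : symplectic o2) (s3 : symplectic o3).
Variables (R : {vspace (V1 * V2)%type}) (S : {vspace (V2 * V3)%type}).
Hypotheses (lR : lagrangian (conj_sum o1 o2) R) (lS : lagrangian (conj_sum o2 o3) S).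

Lemma lagrangian_comp_perp x z :
  (forall x' y' z', (x', y') \in R -> (y', z') \in S -> - o1 x' x + o3 z' z = 0) ->
  exists y, (x, y) \in R /\ (y, z) \in S.
Proof.
move=> H.
have /(lagrangianP (conj_sum_symplectic s1 s2)) pR := lR.
have /(lagrangianP (conj_sum_symplectic s2 s3)) pS := lS.
pose e (j : 'I_(\dim {:V2})) : V2 := (vbasis {:V2})`_j.
pose r (i : 'I_(\dim R)) := (vbasis R)`_i.
pose s (i : 'I_(\dim S)) := (vbasis S)`_i.
have rR i : r i \in R by apply/vbasis_mem/mem_nth; rewrite size_tuple.
have sS i : s i \in S by apply/vbasis_mem/mem_nth; rewrite size_tuple.
pose T : finType := ('I_(\dim R) + 'I_(\dim S))%type.
pose M (j : 'I_(\dim {:V2})) (t : T) : k :=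
  match t with inl i => o2 (r i).2 (e j) | inr i => o2 (s i).1 (e j) end.
pose c (t : T) : k :=
  match t with inl i => o1 (r i).1 x | inr i => o3 (s i).2 z end.
have [t|y Hy] := @fredholm _ _ M c.
  move=> Ht; rewrite big_sumType /=.
  pose rr := \sum_i t (inl i) *: r i.
  pose ss := \sum_i (- t (inr i)) *: s i.
  have rrR : rr \in R by apply: memv_suml => i _; apply: memvZ.
  have ssS : ss \in S by apply: memv_suml => i _; apply: memvZ.
  have rE1 : rr.1 = \sum_i t (inl i) *: (r i).1.
    by rewrite /rr (big_morph (@fst V1 V2) (id1 := 0) (op1 := +%R)).
  have rE2 : rr.2 = \sum_i t (inl i) *: (r i).2.
    by rewrite /rr (big_morph (@snd V1 V2) (id1 := 0) (op1 := +%R)).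
  have sE1 : ss.1 = \sum_i (- t (inr i)) *: (s i).1.
    by rewrite /ss (big_morph (@fst V2 V3) (id1 := 0) (op1 := +%R)).
  have sE2 : ss.2 = \sum_i (- t (inr i)) *: (s i).2.
    by rewrite /ss (big_morph (@snd V2 V3) (id1 := 0) (op1 := +%R)).
  have rs : rr.2 = ss.1.
    apply: (sympl_eq s2) => w.
    rewrite (coord_vbasis (memvf w)) !(sympl_suml s2); apply: eq_bigr => j _.
    congr (_ * _); apply/eqP; rewrite -subr_eq0; apply/eqP.
    rewrite -[(vbasis _)`_j]/(e j) rE2 sE1 !(sympl_sumr s2) -sumrN.
    have := Ht j; rewrite big_sumType /= => /(congr1 -%R).
    rewrite oppr0 => Hj; rewrite -[RHS]Hj opprD -!sumrN; congr (_ + _); apply: eq_bigr => i _.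
      by rewrite (sympl_sym s2) mulrN mulrC.
    by rewrite (sympl_sym s2) mulrN mulNr mulrC opprK.
  have rrE : (rr.1, rr.2) \in R by case: (rr) rrR.
  have ssE : (rr.2, ss.2) \in S by rewrite rs; case: (ss) ssS.
  have := H _ _ _ rrE ssE.
  rewrite rE1 sE2 (sympl_suml s1) (sympl_suml s3) => /(congr1 -%R).
  rewrite oppr0 => Hj; rewrite -[RHS]Hj opprD opprK -sumrN; congr (_ + _); apply: eq_bigr => i _.
    by rewrite mulrC.
  by rewrite mulNr opprK mulrC.
pose yy := \sum_j y j *: e j.
exists yy; split.
  apply/pR => u uR; rewrite /conj_sum /= (coord_vbasis uR).
  rewrite (big_morph (@fst V1 V2) (id1 := 0) (op1 := +%R)) //.
  rewrite (big_morph (@snd V1 V2) (id1 := 0) (op1 := +%R)) //.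
  rewrite (sympl_suml s1) (sympl_suml s2) -sumrN -big_split big1 // => i _ /=.
  rewrite -mulrN -mulrDr -[(vbasis _)`_i]/(r i) (sympl_sumr s2).
  by have /= <- := Hy (inl i); rewrite addNr mulr0.
apply/pS => u uR; rewrite /conj_sum /= (coord_vbasis uR).
rewrite (big_morph (@fst V2 V3) (id1 := 0) (op1 := +%R)) //.
rewrite (big_morph (@snd V2 V3) (id1 := 0) (op1 := +%R)) //.
rewrite (sympl_suml s2) (sympl_suml s3) -sumrN -big_split big1 // => i _ /=.
rewrite -mulrN -mulrDr -[(vbasis _)`_i]/(s i) (sympl_sumr s2).
by have /= <- := Hy (inr i); rewrite addNr mulr0.
Qed.

End Comp.

Lemma is_lagrangian m n (R : linrel k m.*2 n.*2) :
  (forall x y x' y', (x, y) \in R -> (x', y') \in R ->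
     - std_form x x' + std_form y y' = 0) ->
  (forall x y, (forall x' y', (x', y') \in R ->
     - std_form x' x + std_form y' y = 0) -> (x, y) \in R) ->
  lagrangian (@lagrel_form k m n) R.
Proof.
move=> iso perp; apply/(lagrangianP (lagrel_form_symplectic m n)) => -[x y].
split=> [xyR [x' y'] xyR'|H]; first exact: iso.
by apply: perp => x' y' xyR'; apply: (H (x', y')).
Qed.

Lemma lagrangian_iso m n (R : linrel k m.*2 n.*2) x y x' y' :
  lagrangian (@lagrel_form k m n) R ->
  (x, y) \in R -> (x', y') \in R -> - std_form x x' + std_form y y' = 0.
Proof. by move=> [iso _] xyR xyR'; apply: (iso (x, y) (x', y')). Qed.

Lemma lagrangian_perp m n (R : linrel k m.*2 n.*2) x y :
  lagrangian (@lagrel_form k m n) R ->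
  (forall x' y', (x', y') \in R -> - std_form x' x + std_form y' y = 0) ->
  (x, y) \in R.
Proof.
move=> /(lagrangianP (lagrel_form_symplectic m n)) LR H.
by apply/LR => -[x' y'] xyR'; apply: H.
Qed.

Lemma lagrangian_id n : lagrangian (@lagrel_form k n n) (id_rel k n.*2).
Proof.
apply: is_lagrangian => [x y x' y' /id_relP <- /id_relP <-|x y H].
  by rewrite addNr.
apply/id_relP; apply: (sympl_eq (std_form_symplectic n)) => w.
have /eqP := H w w (proj2 (id_relP w w) erefl).
by rewrite addrC subr_eq0 => /eqP.
Qed.

Lemma lagrangian_comp m n p (R : linrel k m.*2 n.*2) (S : linrel k n.*2 p.*2) :
  lagrangian (@lagrel_form k m n) R -> lagrangian (@lagrel_form k n p) S ->
  lagrangian (@lagrel_form k m p) (comp_rel R S).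
Proof.
move=> lR lS; apply: is_lagrangian.
  move=> x z x' z' /comp_relP[y [Rxy Syz]] /comp_relP[y' [Rxy' Syz']].
  have := lagrangian_iso lS Syz Syz'; have := lagrangian_iso lR Rxy Rxy'.
  move/eqP; rewrite addrC subr_eq0 => /eqP ->.
  by [].
move=> x z H; apply/comp_relP.
apply: (lagrangian_comp_perp (std_form_symplectic m) (std_form_symplectic n)
  (std_form_symplectic p) lR lS) => x' y' z' Rxy Syz.
by apply: H; apply/comp_relP; exists y'.
Qed.

(* (k (+) k)^(m + n) is the concatenation of (k (+) k)^m and (k (+) k)^n. *)
Definition dlsub m n (x : 'rV[k]_((m + n).*2)) : 'rV[k]_(m.*2) :=
  lsubmx (castmx (erefl, doubleD m n) x).
Definition drsub m n (x : 'rV[k]_((m + n).*2)) : 'rV[k]_(n.*2) :=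
  rsubmx (castmx (erefl, doubleD m n) x).

Lemma pot_dlsub m n (x : 'rV[k]_((m + n).*2)) i : pot (dlsub x) i = pot x (lshift n i).
Proof. by rewrite /pot mxE castmxE; congr (x _ _); apply: val_inj. Qed.
Lemma cur_dlsub m n (x : 'rV[k]_((m + n).*2)) i : cur (dlsub x) i = cur x (lshift n i).
Proof. by rewrite /cur mxE castmxE; congr (x _ _); apply: val_inj. Qed.
Lemma pot_drsub m n (x : 'rV[k]_((m + n).*2)) i : pot (drsub x) i = pot x (rshift m i).
Proof.
rewrite /pot mxE castmxE; congr (x _ _); apply: val_inj; first by [].
by rewrite /= doubleD.
Qed.
Lemma cur_drsub m n (x : 'rV[k]_((m + n).*2)) i : cur (drsub x) i = cur x (rshift m i).
Proof.
rewrite /cur mxE castmxE; congr (x _ _); apply: val_inj; first by [].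
by rewrite /= doubleD addnS.
Qed.

Lemma std_form_split m n (x y : 'rV[k]_((m + n).*2)) :
  std_form x y = std_form (dlsub x) (dlsub y) + std_form (drsub x) (drsub y).
Proof.
rewrite /std_form big_split_ord /=; congr (_ + _); apply: eq_bigr => i _.
  by rewrite !pot_dlsub !cur_dlsub.
by rewrite !pot_drsub !cur_drsub.
Qed.

Definition drow m n (x : 'rV[k]_(m.*2)) (y : 'rV[k]_(n.*2)) : 'rV[k]_((m + n).*2) :=
  castmx (erefl, esym (doubleD m n)) (row_mx x y).

Lemma dlsub_drow m n (x : 'rV[k]_(m.*2)) (y : 'rV[k]_(n.*2)) : dlsub (drow x y) = x.
Proof. by rewrite /dlsub /drow castmx_comp castmx_id row_mxKl. Qed.
Lemma drsub_drow m n (x : 'rV[k]_(m.*2)) (y : 'rV[k]_(n.*2)) : drsub (drow x y) = y.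
Proof. by rewrite /drsub /drow castmx_comp castmx_id row_mxKr. Qed.

Lemma drow_ext m n (x y : 'rV[k]_((m + n).*2)) :
  dlsub x = dlsub y -> drsub x = drsub y -> x = y.
Proof.
move=> e1 e2; apply: (can_inj (castmxK erefl (doubleD m n))).
exact: row_splitP.
Qed.

Lemma dtens_relP m n m' n' (R : linrel k m.*2 n.*2) (S : linrel k m'.*2 n'.*2) x y :
  (x, y) \in castm (esym (doubleD m m')) (esym (doubleD n n')) (tens_rel R S) <->
  (dlsub x, dlsub y) \in R /\ (drsub x, drsub y) \in S.
Proof. by rewrite cast_relP !esymK tens_relP. Qed.

Lemma dswap_relP m n x y :
  (x, y) \in castm (esym (doubleD m n)) (esym (doubleD n m)) (swap_rel k m.*2 n.*2) <->
  dlsub x = drsub y /\ drsub x = dlsub y.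
Proof. by rewrite cast_relP !esymK swap_relP. Qed.

Lemma lagrangian_tens m n m' n' (R : linrel k m.*2 n.*2) (S : linrel k m'.*2 n'.*2) :
  lagrangian (@lagrel_form k m n) R -> lagrangian (@lagrel_form k m' n') S ->
  lagrangian (@lagrel_form k (m + m') (n + n'))
    (castm (esym (doubleD m m')) (esym (doubleD n n')) (tens_rel R S)).
Proof.
move=> lR lS; apply: is_lagrangian.
  move=> x y x' y' /dtens_relP[R1 S1] /dtens_relP[R2 S2].
  rewrite !std_form_split opprD addrACA.
  by rewrite (lagrangian_iso lR R1 R2) (lagrangian_iso lS S1 S2) addr0.
move=> x y H; apply/dtens_relP; split.
  apply: (lagrangian_perp lR) => x' y' Rxy.
  have := H (drow x' 0) (drow y' 0).
  rewrite !std_form_split !dlsub_drow !drsub_drow.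
  rewrite !(sympl_0l (std_form_symplectic _)) !addr0; apply.
  by apply/dtens_relP; rewrite !dlsub_drow !drsub_drow; split=> //; apply: linrel0.
apply: (lagrangian_perp lS) => x' y' Sxy.
have := H (drow 0 x') (drow 0 y').
rewrite !std_form_split !dlsub_drow !drsub_drow.
rewrite !(sympl_0l (std_form_symplectic _)) !add0r; apply.
by apply/dtens_relP; rewrite !dlsub_drow !drsub_drow; split=> //; apply: linrel0.
Qed.

Lemma lagrangian_swap m n :
  lagrangian (@lagrel_form k (m + n) (n + m))
    (castm (esym (doubleD m n)) (esym (doubleD n m)) (swap_rel k m.*2 n.*2)).
Proof.
apply: is_lagrangian.
  move=> x y x' y' /dswap_relP[e1 e2] /dswap_relP[e3 e4].
  by rewrite !std_form_split e1 e2 e3 e4 [X in - X]addrC addNr.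
move=> x y H.
have -> : y = drow (drsub x) (dlsub x).
  apply: (sympl_eq (std_form_symplectic _)) => w.
  have := H (drow (drsub w) (dlsub w)) w.
  rewrite dswap_relP !dlsub_drow !drsub_drow => /(_ (conj erefl erefl)) /eqP.
  rewrite addrC subr_eq0 => /eqP ->.
  by rewrite !std_form_split !dlsub_drow !drsub_drow addrC.
by apply/dswap_relP; rewrite dlsub_drow drsub_drow.
Qed.

End Symplectic.

(* Pullback of a prop along an endomorphism of the monoid of objects. *)
Section Pullback.
Variables (B : propcat) (d : nat -> nat).
Hypotheses (d0 : d 0%N = 0%N) (dD : forall m n, d (m + n)%N = (d m + d n)%N).

Definition pull_hom m n := B (d m) (d n).
Definition pull_tens m n m' n' (f : pull_hom m n) (g : pull_hom m' n') : pull_hom (m + m') (n + n') :=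
  castm (esym (dD m m')) (esym (dD n n')) (tens f g).
Definition pull_swap m n : pull_hom (m + n) (n + m) :=
  castm (esym (dD m n)) (esym (dD n m)) (swap (d m) (d n)).

Lemma castm_pull m m' n n' (e1 : m = m') (e2 : n = n') (f : pull_hom m n) :
  castm e1 e2 f = castm (H := B) (congr1 d e1) (congr1 d e2) f.
Proof. by case: _ / e1; case: _ / e2. Qed.

Definition pull_prop : propcat.
refine (@PropCat pull_hom (fun m n f g => eqv f g) (fun n => idm (d n))
  (fun m n p f g => pcomp f g) pull_tens pull_swap _ _ _ _ _ _ _ _ _ _ _ _ _ _ _ _).
- by move=> *; apply: eqv_refl.
- by move=> *; apply: eqv_sym.
- by move=> m n f g h *; apply: (eqv_trans (g := g)).
- by move=> *; apply: pcomp_eqv.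
- by move=> *; apply/castm_eqv/tens_eqv.
- by move=> *; apply: pcompA.
- by move=> *; apply: pcomp1l.
- by move=> *; apply: pcomp1r.
- move=> m n; rewrite /pull_tens.
  have := castm_eqv (esym (dD m n)) (esym (dD m n)) (tens_id B (d m) (d n)).
  by rewrite castm_idm.
- move=> m n p m' n' p' f g f' g'; rewrite /pull_tens.
  have := castm_eqv (esym (dD m m')) (esym (dD p p')) (tens_pcomp f g f' g').
  by rewrite (castm_pcomp _ (esym (dD n n'))).
- move=> m n m' n' m'' n'' f g h; rewrite /pull_tens castm_pull.
  have e1 : (d m + (d m' + d m'') = d m + d (m' + m''))%N by rewrite dD.
  have e2 : (d n + (d n' + d n'') = d n + d (n' + n''))%N by rewrite dD.
  have e3 : (d m + d m' + d m'' = d (m + m') + d m'')%N by rewrite dD.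
  have e4 : (d n + d n' + d n'' = d (n + n') + d n'')%N by rewrite dD.
  rewrite -{1}[f](castm_id erefl erefl) (castm_tens erefl erefl _ _ e1 e2).
  rewrite -{2}[h](castm_id erefl erefl) (castm_tens _ _ erefl erefl e3 e4).
  rewrite !castm_comp.
  have := castm_eqv (etrans e3 (esym (dD (m + m')%N m'')))
    (etrans e4 (esym (dD (n + n')%N n''))) (tensA f g h).
  rewrite castm_comp => H; apply: eqv_trans H.
  by rewrite (castm_irr _ (etrans (addnA (d m) (d m') (d m'')) (etrans e3 (esym (dD (m + m')%N m'')))) _ (etrans (addnA (d n) (d n') (d n'')) (etrans e4 (esym (dD (n + n')%N n''))))); apply: eqv_refl.
- move=> m n f; rewrite /pull_tens.
  have e1 : (0 + d m = d 0%N + d m)%N by rewrite d0.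
  have e2 : (0 + d n = d 0%N + d n)%N by rewrite d0.
  rewrite -(castm_idm B (esym d0) (esym d0)) -{1}[f](castm_id erefl erefl).
  rewrite (castm_tens _ _ erefl erefl e1 e2) castm_comp.
  rewrite (castm_irr _ erefl _ erefl); exact: tens0l.
- move=> m n f; rewrite /pull_tens castm_pull.
  have e1 : (d m + 0 = d m + d 0%N)%N by rewrite d0.
  have e2 : (d n + 0 = d n + d 0%N)%N by rewrite d0.
  rewrite -(castm_idm B (esym d0) (esym d0)) -{1}[f](castm_id erefl erefl).
  rewrite (castm_tens erefl erefl _ _ e1 e2) !castm_comp.
  rewrite (castm_irr _ (addn0 (d m)) _ (addn0 (d n))); exact: tens0r.
- move=> m n m' n' f g; rewrite /pull_tens /pull_swap -!castm_pcomp.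
  exact/castm_eqv/swap_nat.
- move=> m n; rewrite /pull_swap -castm_pcomp.
  by have := castm_eqv (esym (dD m n)) (esym (dD m n)) (swapK B (d m) (d n));
    rewrite castm_idm.
- move=> m n p; rewrite /pull_swap /pull_tens !castm_pull.
  have e1 : (d m + (d n + d p) = d m + d (n + p))%N by rewrite dD.
  have e2 : (d n + d p + d m = d (n + p) + d m)%N by rewrite dD.
  rewrite -(castm_swap B erefl (esym (dD n p)) e1 e2).
  have a1 : (d m + d n + d p = d (m + n) + d p)%N by rewrite dD.
  have a2 : (d n + d m + d p = d (n + m) + d p)%N by rewrite dD.
  rewrite -{1}(castm_id erefl erefl (idm (d p))) (castm_tens _ _ erefl erefl a1 a2).
  have b1 : (d n + (d m + d p) = d n + d (m + p))%N by rewrite dD.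
  have b2 : (d n + (d p + d m) = d n + d (p + m))%N by rewrite dD.
  rewrite -{1}(castm_id erefl erefl (idm (d n))) (castm_tens erefl erefl _ _ b1 b2).
  rewrite !castm_comp.
  have c1 : (d n + (d m + d p) = d (n + (m + p)))%N by rewrite !dD.
  have c2 : (d n + (d p + d m) = d (n + (p + m)))%N by rewrite !dD.
  have c3 : (d m + d n + d p = d (m + n + p))%N by rewrite !dD.
  rewrite (castm_irr _ (etrans erefl c3) _ (etrans (esym (addnA (d n) (d m) (d p))) c1)).
  rewrite [X in pcomp _ X](castm_irr _ c1 _ c2).
  rewrite -(castm_comp erefl c3 (esym (addnA (d n) (d m) (d p))) c1).
  rewrite -castm_pcomp castm_comp.
  have := castm_eqv (etrans e1 (esym (dD m (n + p)%N))) (etrans e2 (esym (dD (n + p)%N m)))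
    (swap_hex B (d m) (d n) (d p)).
  rewrite castm_comp => H; apply: eqv_trans H _.
  set X := pcomp _ _.
  by rewrite (castm_irr _ (etrans c3 (congr1 d (esym (addnA m n p)))) _ (etrans c2 (congr1 d (addnA n p m)))); apply: eqv_refl.
Defined.

End Pullback.

Section Subprop.
Variables (B : propcat) (P : forall m n, B m n -> Prop).
Hypotheses (P_id : forall n, P (idm n))
  (P_pcomp : forall m n p (f : B m n) (g : B n p), P f -> P g -> P (pcomp f g))
  (P_tens : forall m n m' n' (f : B m n) (g : B m' n'), P f -> P g -> P (tens f g))
  (P_swap : forall m n, P (swap m n)).

Definition sub_hom m n := {f : B m n | P f}.

Lemma castm_sub m m' n n' (e1 : m = m') (e2 : n = n') (f : sub_hom m n) :
  sval (castm e1 e2 f) = castm e1 e2 (sval f).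
Proof. by case: _ / e1; case: _ / e2. Qed.

Definition sub_prop : propcat.
refine (@PropCat sub_hom (fun m n f g => eqv (sval f) (sval g))
  (fun n => exist _ (idm n) (P_id n))
  (fun m n p f g =>
     exist _ (pcomp (sval f) (sval g)) (P_pcomp (svalP f) (svalP g)))
  (fun m n m' n' f g =>
     exist _ (tens (sval f) (sval g)) (P_tens (svalP f) (svalP g)))
  (fun m n => exist _ (swap m n) (P_swap m n)) _ _ _ _ _ _ _ _ _ _ _ _ _ _ _ _);
  intros; rewrite ?castm_sub /= ?castm_sub /=.
- exact: eqv_refl.
- exact: eqv_sym.
- by apply: eqv_trans; eassumption.
- exact: pcomp_eqv.
- exact: tens_eqv.
- exact: pcompA.
- exact: pcomp1l.
- exact: pcomp1r.
- exact: tens_id.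
- exact: tens_pcomp.
- exact: tensA.
- exact: tens0l.
- exact: tens0r.
- exact: swap_nat.
- exact: swapK.
- exact: swap_hex.
Defined.

End Subprop.

(* The morphisms m -> n of [LagRel k] are the Lagrangian subspaces of
   conj((k (+) k)^m) (+) (k (+) k)^n, seen as morphisms 2m -> 2n of
   [FinRel k]. *)
Definition LagRel (k : fieldType) : propcat :=
  @sub_prop (pull_prop (FinRel k) (erefl : 0.*2 = 0)%N doubleD)
    (fun m n (R : linrel k m.*2 n.*2) => lagrangian (@lagrel_form k m n) R)
    (@lagrangian_id k) (@lagrangian_comp k) (@lagrangian_tens k)
    (@lagrangian_swap k).

Definition LagRel_incl (k : fieldType) : smfunctor (LagRel k) (FinRel k) :=
  @SMFunctor (LagRel k) (FinRel k) double erefl doubleD (fun m n R => sval R)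
    (fun _ _ _ _ => id) (fun _ => erefl) (fun _ _ _ _ _ => erefl)
    (fun _ _ _ _ _ _ => erefl) (fun _ _ => erefl).

Local Open Scope nat_scope.

Record circuit (L : Type) (m n : nat) := Circuit {
  node : finType;
  edge : finType;
  inp : 'I_m -> node;
  out : 'I_n -> node;
  src : edge -> node;
  tgt : edge -> node;
  lab : edge -> L
}.

Arguments inp {L m n}.
Arguments out {L m n}.
Arguments src {L m n}.
Arguments tgt {L m n}.
Arguments lab {L m n}.

Definition circ_iso (L : Type) m n (A B : circuit L m n) : Prop :=
  exists (a : node A -> node B) (e : edge A -> edge B),
  [/\ bijective a, bijective e,
      (forall i, a (inp A i) = inp B i) /\ (forall j, a (out A j) = out B j),
      (forall x, a (src A x) = src B (e x)) /\
      (forall x, a (tgt A x) = tgt B (e x)) &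
      forall x, lab A x = lab B (e x)].

(* Pushout of X <-f- I -g-> Y in finite sets: the quotient of X + Y by the
   equivalence relation generated by f i ~ g i, each class being represented
   by its canonical element. *)
Section Pushout.
Variables (I X Y : finType) (f : I -> X) (g : I -> Y).

Definition glue : rel (X + Y) := fun u v =>
  [exists i, ((u == inl (f i)) && (v == inr (g i))) ||
             ((v == inl (f i)) && (u == inr (g i)))].

Lemma glue_sym : symmetric glue.
Proof. by move=> u v; apply: eq_existsb => i; rewrite orbC. Qed.

Lemma glue_csym : connect_sym glue.
Proof. exact: sym_connect_sym glue_sym. Qed.

Definition pushout : finType := {u : (X + Y)%type | fingraph.roots glue u}.

Definition po_class (u : X + Y) : pushout :=
  exist (fun u => fingraph.roots glue u) (fingraph.root glue u) (roots_root glue_csym u).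

Definition po_inl (x : X) : pushout := po_class (inl x).
Definition po_inr (y : Y) : pushout := po_class (inr y).

Lemma po_glue i : po_inl (f i) = po_inr (g i).
Proof.
apply: val_inj; apply/(fingraph.rootP glue_csym)/connect1; apply/existsP; exists i.
by rewrite !eqxx.
Qed.

Lemma po_surj (q : pushout) : (exists x, q = po_inl x) \/ (exists y, q = po_inr y).
Proof.
have qE : q = po_class (val q).
  by apply: val_inj => /=; case: q => u /= /eqP.
by case: (val q) qE => [x|y] ->; [left; exists x | right; exists y].
Qed.

Lemma po_univ (Z : Type) (a : X -> Z) (b : Y -> Z) :
  (forall i, a (f i) = b (g i)) ->
  exists c : pushout -> Z, (forall x, c (po_inl x) = a x) /\
                           (forall y, c (po_inr y) = b y).
Proof.
move=> ab; pose h (u : X + Y) := match u with inl x => a x | inr y => b y end.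
have hg u v : glue u v -> h u = h v.
  case/existsP => i /orP[] /andP[/eqP-> /eqP->] /=; first exact: ab.
  by rewrite ab.
have hc u v : connect glue u v -> h u = h v.
  by case/connectP => p; elim: p u => [|w p IHp] u /= => [_ -> //|/andP[/hg-> /IHp]]; apply.
exists (fun q => h (val q)); split=> [x|y] /=.
  by rewrite -[RHS]/(h (inl x)); apply/esym/hc/connect_root.
by rewrite -[RHS]/(h (inr y)); apply/esym/hc/connect_root.
Qed.

End Pushout.

Section Circ.
Variable L : Type.

Definition circ_id n : circuit L n n :=
  @Circuit L n n 'I_n void id id (of_void _) (of_void _) (of_void _).

Definition circ_comp m n p (A : circuit L m n) (B : circuit L n p) :
    circuit L m p :=
  @Circuit L m p (pushout (out A) (inp B)) (edge A + edge B)%type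
    (fun i => po_inl (out A) (inp B) (inp A i))
    (fun j => po_inr (out A) (inp B) (out B j))
    (fun e => match e with
              | inl x => po_inl (out A) (inp B) (src A x)
              | inr y => po_inr (out A) (inp B) (src B y) end)
    (fun e => match e with
              | inl x => po_inl (out A) (inp B) (tgt A x)
              | inr y => po_inr (out A) (inp B) (tgt B y) end)
    (fun e => match e with inl x => lab A x | inr y => lab B y end).

Definition sum_map (X Y X' Y' : Type) (f : X -> X') (g : Y -> Y')
    (u : X + Y) : X' + Y' :=
  match u with inl x => inl (f x) | inr y => inr (g y) end.

Definition circ_tens m n m' n' (A : circuit L m n) (B : circuit L m' n') :
    circuit L (m + m') (n + n') :=
  @Circuit L (m + m') (n + n') (node A + node B)%type (edge A + edge B)%type
    (fun i => sum_map (inp A) (inp B) (split i))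
    (fun j => sum_map (out A) (out B) (split j))
    (sum_map (src A) (src B)) (sum_map (tgt A) (tgt B))
    (fun e => match e with inl x => lab A x | inr y => lab B y end).

(* Output j < n is input m + j, and output n + i is input i. *)
Definition swap_ord m n (j : 'I_(n + m)) : 'I_(m + n) :=
  match split j with inl a => rshift m a | inr b => lshift n b end.

Definition circ_swap m n : circuit L (m + n) (n + m) :=
  @Circuit L (m + n) (n + m) 'I_(m + n) void id (@swap_ord m n)
    (of_void _) (of_void _) (of_void _).

(* Isomorphism of circuits over reindexed boundaries. *)
Definition iso_along m n m' n' (r : 'I_m -> 'I_m') (s : 'I_n -> 'I_n')
    (A : circuit L m n) (B : circuit L m' n')
    (a : node A -> node B) (e : edge A -> edge B) :=
  [/\ (forall i, a (inp A i) = inp B (r i)) /\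
      (forall j, a (out A j) = out B (s j)),
      (forall x, a (src A x) = src B (e x)) /\
      (forall x, a (tgt A x) = tgt B (e x)) &
      forall x, lab A x = lab B (e x)].

Lemma cast_circ_iso m n m' n' (e1 : m = m') (e2 : n = n')
  (A : circuit L m n) (B : circuit L m' n')
  (a : node A -> node B) (e : edge A -> edge B) :
  bijective a -> bijective e ->
  iso_along (cast_ord e1) (cast_ord e2) a e ->
  circ_iso (castm e1 e2 A) B.
Proof.
case: _ / e1 B a e => B; case: _ / e2 B => B a e ba be [[h1 h2] h3 h4].
exists a, e; split=> //; split=> i; [rewrite h1 | rewrite h2];
  by congr (_ _ _); apply: val_inj.
Qed.

Lemma circ_iso_refl m n (A : circuit L m n) : circ_iso A A.
Proof. by exists id, id; split=> //; exists id. Qed.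

Lemma circ_iso_sym m n (A B : circuit L m n) : circ_iso A B -> circ_iso B A.
Proof.
move=> [a [e [[a' aK a'K] [e' eK e'K] [h1 h2] [h3 h4] h5]]].
exists a', e'; split.
- by exists a.
- by exists e.
- by split=> i; rewrite -?h1 -?h2 aK.
- by split=> x; rewrite -{1}[x]e'K -?h3 -?h4 aK.
- by move=> x; rewrite -{1}[x]e'K h5.
Qed.

Lemma circ_iso_trans m n (A B C : circuit L m n) :
  circ_iso A B -> circ_iso B C -> circ_iso A C.
Proof.
move=> [a [e [ba be [h1 h2] [h3 h4] h5]]] [a' [e' [ba' be' [h1' h2'] [h3' h4'] h5']]].
exists (a' \o a), (e' \o e); split.
- exact: bij_comp.
- exact: bij_comp.
- by split=> i /=; rewrite ?h1 ?h2.
- by split=> x /=; rewrite ?h3 ?h4.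
- by move=> x /=; rewrite h5 h5'.
Qed.

(* [C] is a composite of [A] and [B], for some choice of the pushout. *)
Definition composite m n p (A : circuit L m n) (B : circuit L n p)
    (C : circuit L m p) : Prop :=
  exists (a : node A -> node C) (b : node B -> node C)
         (e : edge A -> edge C) (f : edge B -> edge C),
  [/\ (forall i, a (out A i) = b (inp B i)) /\
      (forall (Z : finType) (a' : node A -> Z) (b' : node B -> Z),
         (forall i, a' (out A i) = b' (inp B i)) ->
         exists c : node C -> Z, (forall x, c (a x) = a' x) /\
                                 (forall y, c (b y) = b' y)),
      (forall q, (exists x, q = a x) \/ (exists y, q = b y)),
      bijective (fun u => match u with inl x => e x | inr y => f y end),
      (forall i, inp C i = a (inp A i)) /\ (forall j, out C j = b (out B j)) &
      [/\ (forall x, src C (e x) = a (src A x)),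
          (forall x, tgt C (e x) = a (tgt A x)),
          (forall x, src C (f x) = b (src B x)),
          (forall x, tgt C (f x) = b (tgt B x)) &
          (forall x, lab C (e x) = lab A x) /\
          (forall x, lab C (f x) = lab B x)]].

Lemma circ_compP m n p (A : circuit L m n) (B : circuit L n p) :
  composite A B (circ_comp A B).
Proof.
exists (po_inl (out A) (inp B)), (po_inr (out A) (inp B)), inl, inr; split=> //.
- split; first exact: po_glue.
  by move=> Z a' b' ab; apply: po_univ.
- exact: po_surj.
- by exists id => [[]|[]].
Qed.

Lemma composite_iso m n p (A A' : circuit L m n) (B B' : circuit L n p) C C' :
  circ_iso A A' -> circ_iso B B' -> composite A B C -> composite A' B' C' ->
  circ_iso C C'.
Proof.
move=> [g [ge [bg bge [hg1 hg2] [hg3 hg4] hg5]]].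
move=> [h [he [bh bhe [hh1 hh2] [hh3 hh4] hh5]]].
move=> [a [b [e [f [[gl un] su bi [ii oo] [s1 t1 s2 t2 [l1 l2]]]]]]].
move=> [a' [b' [e' [f' [[gl' un'] su' bi' [ii' oo'] [s1' t1' s2' t2' [l1' l2']]]]]]].
have [|c [ca cb]] := un _ (a' \o g) (b' \o h).
  by move=> i /=; rewrite hg2 hh1.
case: bg => ig gK igK; case: bh => ih hK ihK.
have [|c' [ca' cb']] := un' _ (a \o ig) (b \o ih).
  by move=> i /=; rewrite -hg2 -hh1 gK hK.
case: bi => w wK Kw; case: bi' => w' wK' Kw'.
case: bge => ige geK igeK; case: bhe => ihe heK iheK.
pose F x := match w x with inl u => e' (ge u) | inr u => f' (he u) end.
pose G x := match w' x with inl u => e (ige u) | inr u => f (ihe u) end.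
have wE u : w (e u) = inl u by rewrite -[RHS]wK.
have wF u : w (f u) = inr u by rewrite -[RHS]wK.
have wE' u : w' (e' u) = inl u by rewrite -[RHS]wK'.
have wF' u : w' (f' u) = inr u by rewrite -[RHS]wK'.
exists c, F; split.
- exists c' => q.
    by case: (su q) => [[x ->]|[x ->]]; rewrite ?ca ?cb /= ?ca' ?cb' /= ?gK ?hK.
  by case: (su' q) => [[x ->]|[x ->]]; rewrite ?ca' ?cb' /= ?ca ?cb /= ?igK ?ihK.
- exists G => x; rewrite /F /G.
    by rewrite -{2}(Kw x); case: (w x) => u; rewrite ?wE' ?wF' ?geK ?heK.
  by rewrite -{2}(Kw' x); case: (w' x) => u; rewrite ?wE ?wF ?igeK ?iheK.
- by split=> i; rewrite ?ii ?oo ?ca ?cb /= ?hg1 ?hh2 ?ii' ?oo'.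
- split=> x; rewrite /F -{1}(Kw x); case: (w x) => u.
  + by rewrite s1 ca /= hg3 s1'.
  + by rewrite s2 cb /= hh3 s2'.
  + by rewrite t1 ca /= hg4 t1'.
  + by rewrite t2 cb /= hh4 t2'.
- move=> x; rewrite /F -{1}(Kw x); case: (w x) => u.
  + by rewrite l1 hg5 l1'.
  + by rewrite l2 hh5 l2'.
Qed.

Lemma composite_eq m n p (A : circuit L m n) (B : circuit L n p) C :
  composite A B C -> circ_iso (circ_comp A B) C.
Proof.
by move=> ABC; apply: composite_iso (circ_compP A B) ABC; apply: circ_iso_refl.
Qed.

Lemma circ_comp_eqv m n p (A A' : circuit L m n) (B B' : circuit L n p) :
  circ_iso A A' -> circ_iso B B' -> circ_iso (circ_comp A B) (circ_comp A' B').
Proof. by move=> AA BB; apply: composite_iso AA BB _ _; apply: circ_compP. Qed.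

Lemma sum_map_bij (X Y X' Y' : Type) (f : X -> X') (g : Y -> Y') :
  bijective f -> bijective g -> bijective (sum_map f g).
Proof.
move=> [f' fK Kf] [g' gK Kg]; exists (sum_map f' g') => [[]|[]] x /=;
by rewrite ?fK ?gK ?Kf ?Kg.
Qed.

Lemma circ_tens_eqv m n m' n' (A A' : circuit L m n) (B B' : circuit L m' n') :
  circ_iso A A' -> circ_iso B B' -> circ_iso (circ_tens A B) (circ_tens A' B').
Proof.
move=> [g [ge [bg bge [hg1 hg2] [hg3 hg4] hg5]]].
move=> [h [he [bh bhe [hh1 hh2] [hh3 hh4] hh5]]].
exists (sum_map g h), (sum_map ge he); split.
- exact: sum_map_bij.
- exact: sum_map_bij.
- by split=> i /=; case: split => j /=; rewrite ?hg1 ?hg2 ?hh1 ?hh2.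
- by split=> -[] x /=; rewrite ?hg3 ?hg4 ?hh3 ?hh4.
- by case=> x /=.
Qed.

Lemma circ_compA m n p q (A : circuit L m n) (B : circuit L n p) (C : circuit L p q) :
  circ_iso (circ_comp A (circ_comp B C)) (circ_comp (circ_comp A B) C).
Proof.
apply: composite_eq.
have [b [c [e [f [[gl un] su bi [ii oo] H]]]]] := circ_compP B C.
set AB := circ_comp A B; set D := circ_comp AB C.
pose a1 : node A -> node D := fun x => po_inl _ _ (po_inl _ _ x).
pose b1 : node B -> node D := fun x => po_inl _ _ (po_inr _ _ x).
pose c1 : node C -> node D := fun x => po_inr _ _ x.
have glAB i : a1 (out A i) = b1 (inp B i) by rewrite /a1 po_glue.
have glBC i : b1 (out B i) = c1 (inp C i) by exact: (po_glue (out AB) (inp C) i).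
have [bc [bcb bcc]] := @po_univ _ _ _ (out B) (inp C) _ b1 c1 glBC.
exists a1, bc, (fun x => inl (inl x)),
  (fun u => match u with inl x => inl (inr x) | inr x => inr x end); split.
- split; first by move=> i; rewrite bcb.
  move=> Z a' bc' H'.
  have [u [ua ub]] := @po_univ _ _ _ (out A) (inp B) _ a' (fun y => bc' (po_inl _ _ y)) H'.
  have [|v [va vb]] := @po_univ _ _ _ (out AB) (inp C) _ u (fun y => bc' (po_inr _ _ y)).
    by move=> i /=; rewrite ub po_glue.
  exists v; split=> [x|y]; first by rewrite /a1 va ua.
  by case: (po_surj y) => [[x ->]|[x ->]]; rewrite ?bcb ?bcc ?va ?ub ?vb.
- move=> y; case: (po_surj y) => [[w ->]|[x ->]]; last first.
    by right; exists (po_inr _ _ x); rewrite bcc.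
  case: (po_surj w) => [[x ->]|[x ->]]; first by left; exists x.
  by right; exists (po_inl _ _ x); rewrite bcb.
- by exists (fun u => match u with
     | inl (inl x) => inl x | inl (inr x) => inr (inl x) | inr x => inr (inr x) end)
     => [[x|[x|x]]|[[x|x]|x]].
- by split=> // i /=; rewrite bcc.
- by split=> //; [case=> x /=; rewrite ?bcb ?bcc | case=> x /=; rewrite ?bcb ?bcc
    | split=> // -[]].
Qed.

Lemma circ_comp1l m n (A : circuit L m n) : circ_iso (circ_comp (circ_id m) A) A.
Proof.
apply: composite_eq; exists (inp A), id, (of_void _), id; split=> //.
- by split=> // Z a' b' H; exists b'; split=> // x; rewrite -H.
- by move=> q; right; exists q.
- by exists inr => // -[].
Qed.

Lemma circ_comp1r m n (A : circuit L m n) : circ_iso (circ_comp A (circ_id n)) A.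
Proof.
apply: composite_eq; exists id, (out A), id, (of_void _); split=> //.
- by split=> // Z a' b' H; exists a'; split=> // x; rewrite H.
- by move=> q; left; exists q.
- by exists inl => // -[].
Qed.

Lemma circ_tens_id m n :
  circ_iso (circ_tens (circ_id m) (circ_id n)) (circ_id (m + n)).
Proof.
exists (@unsplit m n), (fun u => match u with inl x => x | inr x => x end); split.
- by exists (@split m n); [apply: unsplitK | apply: splitK].
- by exists inl => [[]|] [].
- by split=> i /=; rewrite -[RHS]splitK; case: (split i).
- by split=> -[] [].
- by case=> -[].
Qed.

Lemma split_inlP m n (P : 'I_m + 'I_n -> Prop) :
  (forall i, P (split i)) -> (forall j, P (inl j)) /\ (forall j, P (inr j)).
Proof.
by move=> H; split=> j; [have := H (lshift n j) | have := H (rshift m j)];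
  [rewrite (unsplitK (inl j)) | rewrite (unsplitK (inr j))].
Qed.

Lemma circ_tens_comp m n p m' n' p' (f : circuit L m n) (g : circuit L n p)
  (f' : circuit L m' n') (g' : circuit L n' p') :
  circ_iso (circ_tens (circ_comp f g) (circ_comp f' g'))
           (circ_comp (circ_tens f f') (circ_tens g g')).
Proof.
apply/circ_iso_sym/composite_eq.
exists (sum_map (po_inl _ _) (po_inl _ _)), (sum_map (po_inr _ _) (po_inr _ _)),
  (sum_map inl inl), (sum_map inr inr); split.
- split; first by move=> i /=; case: split => j /=; rewrite po_glue.
  move=> Z a b H.
  have [H1 H2] := @split_inlP _ _ (fun u => a (sum_map (out f) (out f') u) =
    b (sum_map (inp g) (inp g') u)) H.
  have [u [ua ub]] := @po_univ _ _ _ (out f) (inp g) _ (a \o inl) (b \o inl) H1.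
  have [v [va vb]] := @po_univ _ _ _ (out f') (inp g') _ (a \o inr) (b \o inr) H2.
  exists (fun w => match w with inl x => u x | inr x => v x end).
  by split=> -[] x /=; rewrite ?ua ?ub ?va ?vb.
- case=> q; case: (po_surj q) => [[x ->]|[x ->]].
  + by left; exists (inl x).
  + by right; exists (inl x).
  + by left; exists (inr x).
  + by right; exists (inr x).
- by exists (fun u => match u with
     | inl (inl x) => inl (inl x) | inl (inr x) => inr (inl x)
     | inr (inl x) => inl (inr x) | inr (inr x) => inr (inr x) end)
   => [[[x|x]|[x|x]]|[[x|x]|[x|x]]].
- by split=> i /=; case: split.
- by split=> [[]|[]|[]|[]|] //; split=> -[].
Qed.

Lemma split_assocP m n p (i : 'I_(m + (n + p))) :
  split (cast_ord (addnA m n p) i) =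
  match split i with
  | inl a => inl (lshift n a)
  | inr u => match split u with
             | inl b => inl (rshift m b)
             | inr c => inr c
             end
  end.
Proof.
rewrite -[i]splitK; case: (split i) => [a|u] /=; rewrite ?(unsplitK (inl a)) ?(unsplitK (inr u)) /=.
  by rewrite -[RHS]unsplitK /=; congr split; apply: val_inj.
rewrite -[u]splitK; case: (split u) => [b|c] /=; rewrite ?(unsplitK (inl b)) ?(unsplitK (inr c)) /=.
  by rewrite -[RHS]unsplitK /=; congr split; apply: val_inj.
by rewrite -[RHS]unsplitK /=; congr split; apply: val_inj; rewrite /= addnA.
Qed.

Definition sum_assoc (X Y Z : Type) (u : X + (Y + Z)) : X + Y + Z :=
  match u with
  | inl x => inl (inl x) | inr (inl x) => inl (inr x) | inr (inr x) => inr x end.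

Lemma sum_assoc_bij X Y Z : bijective (@sum_assoc X Y Z).
Proof.
by exists (fun u => match u with
   | inl (inl x) => inl x | inl (inr x) => inr (inl x) | inr x => inr (inr x) end)
     => [[x|[x|x]]|[[x|x]|x]].
Qed.

Lemma circ_tensA m n m' n' m'' n'' (f : circuit L m n) (g : circuit L m' n')
  (h : circuit L m'' n'') :
  circ_iso (castm (addnA m m' m'') (addnA n n' n'') (circ_tens f (circ_tens g h)))
           (circ_tens (circ_tens f g) h).
Proof.
apply: (@cast_circ_iso _ _ _ _ _ _ (circ_tens f (circ_tens g h)) (circ_tens (circ_tens f g) h)
  (@sum_assoc (node f) (node g) (node h)) (@sum_assoc (edge f) (edge g) (edge h))).
- exact: sum_assoc_bij.
- exact: sum_assoc_bij.
split.
- split=> i /=; rewrite split_assocP; case: (split i) => [a|u] /=;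
    rewrite ?(unsplitK (inl a)) //=; case: (split u) => [b|c] //=;
    by rewrite (unsplitK (inr b)).
- by split=> -[x|[x|x]].
- by case=> [x|[x|x]].
Qed.

Definition ord0_elim (T : Type) (x : 'I_0) : T :=
  False_rect T (notF (ltn_ord x)).

Lemma circ_tens0l m n (f : circuit L m n) : circ_iso (circ_tens (circ_id 0) f) f.
Proof.
have sp p (i : 'I_(0 + p)) : split i = inr i.
  by rewrite -[RHS](@unsplitK 0 p (inr i)); congr split; apply: val_inj.
exists (fun u => match u with inl x => ord0_elim _ x | inr x => x end),
  (fun u => match u with inl x => of_void _ x | inr x => x end); split.
- by exists inr => // -[[]|].
- by exists inr => // -[[]|].
- by split=> i /=; rewrite sp.
- by split=> -[[]|].
- by case=> [[]|].
Qed.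

Lemma circ_tens0r m n (f : circuit L m n) :
  circ_iso (castm (addn0 m) (addn0 n) (circ_tens f (circ_id 0))) f.
Proof.
apply: (@cast_circ_iso _ _ _ _ _ _ (circ_tens f (circ_id 0)) f
  (fun u : node f + 'I_0 => match u with inr x => ord0_elim _ x | inl x => x end)
  (fun u : edge f + void => match u with inr x => of_void _ x | inl x => x end)).
- by exists inl => // -[|[]].
- by exists inl => // -[|[]].
split.
- have sp p (i : 'I_(p + 0)) : split i = inl (cast_ord (addn0 p) i).
    by rewrite -[RHS]unsplitK; congr split; apply: val_inj.
  by split=> i /=; rewrite sp.
- by split=> -[|[]].
- by case=> [|[]].
Qed.

Lemma split_swap_ord m n (i : 'I_(n + m)) :
  split (swap_ord i) = match split i with inl a => inr a | inr b => inl b end.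
Proof.
by rewrite /swap_ord; case: (split i) => a; [rewrite (unsplitK (inr a)) | rewrite (unsplitK (inl a))].
Qed.

Lemma swap_ordK m n : cancel (@swap_ord m n) (@swap_ord n m).
Proof.
move=> i; rewrite /swap_ord -/(swap_ord i).
by rewrite split_swap_ord -[RHS]splitK; case: (split i).
Qed.

Lemma circ_swap_nat m n m' n' (f : circuit L m n) (g : circuit L m' n') :
  circ_iso (circ_comp (circ_tens f g) (circ_swap n n'))
           (circ_comp (circ_swap m m') (circ_tens g f)).
Proof.
pose C := @Circuit L (m + m') (n' + n) (node f + node g)%type (edge f + edge g)%type
  (inp (circ_tens f g)) (out (circ_tens f g) \o @swap_ord n n')
  (src (circ_tens f g)) (tgt (circ_tens f g)) (lab (circ_tens f g)).
apply: (@circ_iso_trans _ _ _ C).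
  apply: composite_eq; exists id, (out (circ_tens f g)), id, (of_void _); split=> //.
  - by split=> // Z a b H; exists a; split=> // i; rewrite H.
  - by move=> q; left; exists q.
  - by exists inl => // -[].
apply/circ_iso_sym/composite_eq.
pose sw (X Y : Type) (u : X + Y) : Y + X := match u with inl x => inr x | inr x => inl x end.
exists (fun i => sw _ _ (sum_map (inp g) (inp f) (split (swap_ord i)))),
  (@sw _ _), (of_void _), (@sw _ _); split.
- split.
    by move=> i /=; rewrite swap_ordK.
  move=> Z a b H; exists (fun u => b (sw _ _ u)); split=> [i|[]//].
  have := H (swap_ord i); rewrite /= swap_ordK => ->.
  by case: (split _).
- by move=> q; right; exists (sw _ _ q); case: q.
- by exists (fun u => inr (sw _ _ u)) => [[[]|[]]|[]].
- by split=> i /=; rewrite split_swap_ord; case: (split i).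
- by split=> [[]|[]|[]|[]|] //; split=> -[].
Qed.

Lemma circ_swapK m n :
  circ_iso (circ_comp (circ_swap m n) (circ_swap n m)) (circ_id (m + n)).
Proof.
apply: composite_eq; exists id, (@swap_ord m n), id, id; split=> //.
- by split=> // Z a b H; exists a; split=> // i; apply: H.
- by move=> q; left; exists q.
- by exists inl => [[[]|[]]|[]].
- by split=> // i /=; rewrite swap_ordK.
Qed.

(* A circuit without edges whose nodes are its inputs. *)
Definition circ_perm m n (s : 'I_n -> 'I_m) : circuit L m n :=
  @Circuit L m n 'I_m void id s (of_void _) (of_void _) (of_void _).

Lemma circ_perm_comp m n p (s : 'I_n -> 'I_m) (t : 'I_p -> 'I_n) :
  circ_iso (circ_comp (circ_perm s) (circ_perm t)) (circ_perm (s \o t)).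
Proof.
apply: composite_eq; exists id, s, id, id; split=> //.
- by split=> // Z a b H; exists a; split=> // i; apply: H.
- by move=> q; left; exists q.
- by exists inl => [[[]|[]]|[]].
Qed.

Lemma circ_perm_tens m n m' n' (s : 'I_n -> 'I_m) (t : 'I_n' -> 'I_m') :
  circ_iso (circ_tens (circ_perm s) (circ_perm t))
           (circ_perm (fun i => unsplit (sum_map s t (split i)))).
Proof.
exists (@unsplit m m'), (fun u => match u with inl x => x | inr x => x end); split.
- by exists (@split m m'); [apply: unsplitK | apply: splitK].
- by exists inl => [[]|] [].
- by split=> i //=; rewrite -[RHS]splitK; case: (split i).
- by split=> -[] [].
- by case=> -[].
Qed.

Lemma circ_perm_cast m n m' n' (e1 : m = m') (e2 : n = n') (s : 'I_n -> 'I_m) :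
  castm e1 e2 (circ_perm s) =
  circ_perm (fun i => cast_ord e1 (s (cast_ord (esym e2) i))).
Proof.
case: _ / e1; case: _ / e2; congr circ_perm; apply: funext => i.
by rewrite !cast_ord_id.
Qed.

Lemma circ_iso_cast m n m' n' (e1 : m = m') (e2 : n = n') (A B : circuit L m n) :
  circ_iso A B -> circ_iso (castm e1 e2 A) (castm e1 e2 B).
Proof. by case: _ / e1; case: _ / e2. Qed.

Lemma circ_swap_hex m n p :
  circ_iso (circ_swap m (n + p))
    (castm (esym (addnA m n p)) (addnA n p m)
      (circ_comp
        (castm erefl (esym (addnA n m p)) (circ_tens (circ_swap m n) (circ_id p)))
        (circ_tens (circ_id n) (circ_swap m p)))).
Proof.
apply/circ_iso_sym.
have H1 := circ_iso_cast erefl (esym (addnA n m p)) (circ_perm_tens (@swap_ord m n) (@id 'I_p)).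
have H2 := circ_perm_tens (@id 'I_n) (@swap_ord m p).
rewrite circ_perm_cast in H1.
apply: circ_iso_trans (circ_iso_cast _ _ (circ_comp_eqv H1 H2)) _.
apply: circ_iso_trans (circ_iso_cast _ _ (circ_perm_comp _ _)) _.
rewrite circ_perm_cast.
set s := (fun i => _); suff -> : s = @swap_ord m (n + p) by apply: circ_iso_refl.
apply: funext => i; apply: val_inj; rewrite /s /= /swap_ord.
rewrite !esymK.
have spl a b (j : 'I_a) : split (lshift b j) = inl j by apply: (unsplitK (inl j)).
have spr a b (j : 'I_b) : split (rshift a j) = inr j by apply: (unsplitK (inr j)).
rewrite -[i]splitK; case: (split i) => [u|c] /=; rewrite ?spl ?spr /=; last first.
  rewrite (_ : cast_ord _ _ = rshift n (rshift p c)); last by apply: val_inj; rewrite /= addnA.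
  rewrite spr /= spr /= (_ : cast_ord _ _ = lshift p (rshift n c)); last exact: val_inj.
  by rewrite spl /= spr.
rewrite -[u]splitK; case: (split u) => [a|b] /=.
  rewrite (_ : cast_ord _ _ = lshift (p + m) a); last exact: val_inj.
  rewrite spl /= (_ : cast_ord _ _ = lshift p (lshift m a)); last exact: val_inj.
  by rewrite spl /= spl.
rewrite (_ : cast_ord _ _ = rshift n (lshift m b)); last exact: val_inj.
rewrite spr /= spl /= (_ : cast_ord _ _ = rshift (n + m) b); last by apply: val_inj; rewrite /= addnA.
by rewrite spr /= addnA.
Qed.

Definition Circ : propcat :=
  @PropCat (circuit L) (@circ_iso L) circ_id circ_comp circ_tens circ_swap
    circ_iso_refl circ_iso_sym circ_iso_trans circ_comp_eqv circ_tens_eqv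
    circ_compA circ_comp1l circ_comp1r circ_tens_id circ_tens_comp circ_tensA
    circ_tens0l circ_tens0r circ_swap_nat circ_swapK circ_swap_hex.

(* The circuit without edges given by a cospan of finite sets. *)
Definition cospan_circ m n (N : finType) (i : 'I_m -> N) (o : 'I_n -> N) :
    circuit L m n :=
  @Circuit L m n N void i o (of_void _) (of_void _) (of_void _).

(* Two nodes and one edge labelled [l] from the input to the output. *)
Definition edge_circ (l : L) : circuit L 1 1 :=
  @Circuit L 1 1 'I_2 unit (fun _ => ord0) (fun _ => ord_max)
    (fun _ => ord0) (fun _ => ord_max) (fun _ => l).

End Circ.

Inductive Sigma : signature :=
| Mu : Sigma 2 1
| Iota : Sigma 0 1
| Delta : Sigma 1 2
| Epsilon : Sigma 1 0.

(* One operation 1 -> 1 for each element of [L], and no others. *)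
Inductive unary_sig (L : Type) : signature :=
| Op (l : L) : unary_sig L 1 1.

Definition SigFlow (k : fieldType) : propcat :=
  coprod (coprod (free_prop Sigma) (free_prop Sigma)) (free_prop (unary_sig k)).

Definition CircTilde (k : fieldType) : propcat :=
  coprod (free_prop Sigma) (free_prop (unary_sig k)).

Section Morphisms.
Variable k : fieldType.

(* The quotient map imposing the laws of special commutative Frobenius monoids
   on the object 1; [Circ k] plays the role of FinCospan + F(k). *)
Definition circ_gen m n (s : Sigma m n) : Circ k m n :=
  match s in Sigma m n return circuit k m n with
  | Mu => cospan_circ k (fun _ : 'I_2 => ord0 : 'I_1) (fun _ : 'I_1 => ord0)
  | Iota => cospan_circ k (fun _ : 'I_0 => ord0 : 'I_1) (fun _ : 'I_1 => ord0)
  | Delta => cospan_circ k (fun _ : 'I_1 => ord0 : 'I_1) (fun _ : 'I_2 => ord0)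
  | Epsilon => cospan_circ k (fun _ : 'I_1 => ord0 : 'I_1) (fun _ : 'I_0 => ord0)
  end.

Definition circ_op m n (s : unary_sig k m n) : Circ k m n :=
  match s in unary_sig _ m n return circuit k m n with
  | Op c => edge_circ c
  end.

Definition circ_proj : prop_morph (CircTilde k) (Circ k) :=
  copair (free_lift circ_gen) (free_lift circ_op).

Local Open Scope ring_scope.

Definition rvec (s : seq k) : 'rV[k]_(size s) := \row_j s`_j.

Definition dup_set (u : 'rV[k]_1 * 'rV[k]_2) : Prop :=
  exists x : k, u = (rvec [:: x], rvec [:: x; x]).
Definition del_set (u : 'rV[k]_1 * 'rV[k]_0) : Prop :=
  exists x : k, u = (rvec [:: x], rvec [::]).
Definition codup_set (u : 'rV[k]_2 * 'rV[k]_1) : Prop :=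
  exists x : k, u = (rvec [:: x; x], rvec [:: x]).
Definition codel_set (u : 'rV[k]_0 * 'rV[k]_1) : Prop :=
  exists x : k, u = (rvec [::], rvec [:: x]).
Definition add_set (u : 'rV[k]_2 * 'rV[k]_1) : Prop :=
  exists x y : k, u = (rvec [:: x; y], rvec [:: x + y]).
Definition zero_set (u : 'rV[k]_0 * 'rV[k]_1) : Prop :=
  u = (rvec [::], rvec [:: 0]).
Definition coadd_set (u : 'rV[k]_1 * 'rV[k]_2) : Prop :=
  exists x y : k, u = (rvec [:: x + y], rvec [:: x; y]).
Definition cozero_set (u : 'rV[k]_1 * 'rV[k]_0) : Prop :=
  u = (rvec [:: 0], rvec [::]).
Definition scal_set (c : k) (u : 'rV[k]_1 * 'rV[k]_1) : Prop :=
  exists x : k, u = (rvec [:: x], rvec [:: c * x]).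

Lemma rvec0 (x : 'rV[k]_0) : x = rvec [::].
Proof. exact: row0. Qed.

Lemma rvec1 (x : 'rV[k]_1) : x = rvec [:: x 0 0].
Proof. by apply/rowP => i; rewrite ord1 mxE. Qed.

Lemma rvec1_lin (a x y : k) :
  a *: rvec [:: x] + rvec [:: y] = rvec [:: a * x + y].
Proof. by apply/rowP => i; rewrite !mxE; case: i => -[|i] //=. Qed.

Lemma rvec2_lin (a x y x' y' : k) :
  a *: rvec [:: x; y] + rvec [:: x'; y'] = rvec [:: a * x + x'; a * y + y'].
Proof. by apply/rowP => i; rewrite !mxE; case: i => -[|[|i]] //=. Qed.

Lemma rvec10 : (0 : 'rV[k]_1) = rvec [:: 0].
Proof. by rewrite [LHS]rvec1 mxE. Qed.

Lemma rvec20 : (0 : 'rV[k]_2) = rvec [:: 0; 0].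
Proof. by apply/rowP => i; rewrite !mxE; case: i => -[|[|i]] //=. Qed.

Lemma dup_lin : lin_closed dup_set.
Proof.
split; first by exists 0; rewrite -rvec10 -rvec20.
by move=> a _ _ [x ->] [y ->]; exists (a * x + y); rewrite -rvec1_lin -rvec2_lin.
Qed.

Lemma del_lin : lin_closed del_set.
Proof.
split; first by exists 0; rewrite -rvec10; congr (_, _); apply: row0.
move=> a _ _ [x ->] [y ->]; exists (a * x + y); rewrite -rvec1_lin.
by congr (_, _); apply: row0.
Qed.

Lemma codup_lin : lin_closed codup_set.
Proof.
split; first by exists 0; rewrite -rvec10 -rvec20.
by move=> a _ _ [x ->] [y ->]; exists (a * x + y); rewrite -rvec1_lin -rvec2_lin.
Qed.

Lemma codel_lin : lin_closed codel_set.
Proof.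
split; first by exists 0; rewrite -rvec10; congr (_, _); apply: row0.
move=> a _ _ [x ->] [y ->]; exists (a * x + y); rewrite -rvec1_lin.
by congr (_, _); apply: row0.
Qed.

Lemma add_lin : lin_closed add_set.
Proof.
split; first by exists 0, 0; rewrite addr0 -rvec10 -rvec20.
move=> a _ _ [x [y ->]] [x' [y' ->]]; exists (a * x + x'), (a * y + y').
by rewrite -rvec2_lin addrACA -mulrDr -rvec1_lin.
Qed.

Lemma zero_lin : lin_closed zero_set.
Proof.
rewrite /zero_set -rvec10; split; first by congr (_, _); apply: row0.
move=> a _ _ -> ->; rewrite -[LHS]/(_, _); congr (_, _); first exact: row0.
by rewrite /= scaler0 addr0.
Qed.

Lemma coadd_lin : lin_closed coadd_set.
Proof.
split; first by exists 0, 0; rewrite addr0 -rvec10 -rvec20.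
move=> a _ _ [x [y ->]] [x' [y' ->]]; exists (a * x + x'), (a * y + y').
by rewrite -rvec2_lin addrACA -mulrDr -rvec1_lin.
Qed.

Lemma cozero_lin : lin_closed cozero_set.
Proof.
rewrite /cozero_set -rvec10; split; first by congr (_, _); apply: row0.
move=> a _ _ -> ->; rewrite -[LHS]/(_, _); congr (_, _); last exact: row0.
by rewrite /= scaler0 addr0.
Qed.

Lemma scal_lin c : lin_closed (scal_set c).
Proof.
split; first by exists 0; rewrite mulr0 -rvec10.
move=> a _ _ [x ->] [y ->]; exists (a * x + y).
by rewrite mulrDr mulrCA -!rvec1_lin.
Qed.

(* Coduplication, codeletion, duplication, deletion. *)
Definition dup_gen m n (s : Sigma m n) : FinRel k m n :=
  match s in Sigma m n return linrel k m n with
  | Mu => subspace codup_lin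
  | Iota => subspace codel_lin
  | Delta => subspace dup_lin
  | Epsilon => subspace del_lin
  end.

(* Addition, zero, coaddition, cozero. *)
Definition add_gen m n (s : Sigma m n) : FinRel k m n :=
  match s in Sigma m n return linrel k m n with
  | Mu => subspace add_lin
  | Iota => subspace zero_lin
  | Delta => subspace coadd_lin
  | Epsilon => subspace cozero_lin
  end.

Definition scal_op m n (s : unary_sig k m n) : FinRel k m n :=
  match s in unary_sig _ m n return linrel k m n with
  | Op c => subspace (scal_lin c)
  end.

Definition sigflow_box : prop_morph (SigFlow k) (FinRel k) :=
  copair (copair (free_lift dup_gen) (free_lift add_gen)) (free_lift scal_op).

Definition lagrel_space m n (R : LagRel k m n) : linrel k m.*2 n.*2 := sval R.

(* The characterization of black-boxing by its values on the generators. *)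
Record is_blackbox (B : prop_morph (Circ k) (LagRel k)) : Prop := IsBlackbox {
  blackbox_mu : forall p1 i1 p2 i2 p3 i3 : k,
    (rvec [:: p1; i1; p2; i2], rvec [:: p3; i3])
      \in lagrel_space (pm B (circ_gen Mu)) <->
    [/\ p1 = p2, p2 = p3 & i1 + i2 = i3];
  blackbox_iota : forall p2 i2 : k,
    (rvec [::], rvec [:: p2; i2])
      \in lagrel_space (pm B (circ_gen Iota)) <-> i2 = 0;
  blackbox_delta : forall p1 i1 p2 i2 p3 i3 : k,
    (rvec [:: p1; i1], rvec [:: p2; i2; p3; i3])
      \in lagrel_space (pm B (circ_gen Delta)) <->
    [/\ p1 = p2, p2 = p3 & i1 = i2 + i3];
  blackbox_epsilon : forall p1 i1 : k,
    (rvec [:: p1; i1], rvec [::])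
      \in lagrel_space (pm B (circ_gen Epsilon)) <-> i1 = 0;
  blackbox_edge : forall z p1 i1 p2 i2 : k,
    (rvec [:: p1; i1], rvec [:: p2; i2])
      \in lagrel_space (pm B (edge_circ z)) <->
    p2 - p1 = z * i1 /\ i1 = i2
}.

End Morphisms.

Section Blackbox.
Variable k : fieldType.
Local Open Scope ring_scope.

(* The boundary behaviours of a circuit extending to potentials on the nodes
   and currents on the edges that satisfy Ohm's law and Kirchhoff's current
   law, the latter being tested against all weights on the nodes. *)
Definition behaviour m n (A : circuit k m n)
    (u : 'rV[k]_(m.*2) * 'rV[k]_(n.*2)) : Prop :=
  exists (phi : node A -> k) (c : edge A -> k),
  [/\ (forall i, pot u.1 i = phi (inp A i)),
      (forall j, pot u.2 j = phi (out A j)),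
      (forall e, phi (tgt A e) - phi (src A e) = lab A e * c e) &
      forall w : node A -> k,
        \sum_i w (inp A i) * cur u.1 i + \sum_e w (tgt A e) * c e =
        \sum_j w (out A j) * cur u.2 j + \sum_e w (src A e) * c e].

Lemma pot_lin n a (x y : 'rV[k]_(n.*2)) i : pot (a *: x + y) i = a * pot x i + pot y i.
Proof. by rewrite /pot !mxE. Qed.
Lemma cur_lin n a (x y : 'rV[k]_(n.*2)) i : cur (a *: x + y) i = a * cur x i + cur y i.
Proof. by rewrite /cur !mxE. Qed.

Lemma behaviour_lin m n (A : circuit k m n) : lin_closed (behaviour A).
Proof.
split.
  exists (fun=> 0), (fun=> 0); split=> [i|j|e|w]; rewrite /pot /cur ?mxE //.
    by rewrite subrr mulr0.
  by rewrite !big1 // => i _; rewrite ?mxE mulr0.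
move=> a [u1 u2] [v1 v2] [p [c [/= h1 h2 h3 h4]]] [p' [c' [/= h1' h2' h3' h4']]].
exists (fun x => a * p x + p' x), (fun e => a * c e + c' e); split=> [i|j|e|w] /=.
- by rewrite pot_lin h1 h1'.
- by rewrite pot_lin h2 h2'.
- rewrite opprD addrACA h3' -mulrBr h3 mulrDr; congr (_ + _).
  by rewrite mulrCA.
- have E (I : finType) (f g g' : I -> k) :
      \sum_i f i * (a * g i + g' i) = a * (\sum_i f i * g i) + \sum_i f i * g' i.
    by rewrite mulr_sumr -big_split; apply: eq_bigr => i _ /=; rewrite mulrDr mulrCA.
  under eq_bigr do rewrite cur_lin.
  under [X in _ = X + _]eq_bigr do rewrite cur_lin.
  by rewrite !E addrACA -mulrDr h4 h4' mulrDr addrACA.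
Qed.

Definition bb_rel m n (A : circuit k m n) : linrel k m.*2 n.*2 :=
  subspace (behaviour_lin A).

Lemma bb_relP m n (A : circuit k m n) x y :
  (x, y) \in bb_rel A <-> behaviour A (x, y).
Proof. exact: subspaceP. Qed.

Lemma sum_delta (I : finType) (i : I) (f : I -> k) :
  \sum_j f j * (i == j)%:R = f i.
Proof.
rewrite (bigD1 i) //= eqxx mulr1 big1 ?addr0 // => j ji.
by rewrite eq_sym (negPf ji) mulr0.
Qed.

Lemma bb_lagrangian m n (A : circuit k m n) :
  lagrangian (@lagrel_form k m n) (bb_rel A).
Proof.
apply: is_lagrangian.
  move=> x y x' y' /bb_relP[p [c [/= h1 h2 h3 h4]]] /bb_relP[p' [c' [/= h1' h2' h3' h4']]].
  have E q (z z' : 'rV[k]_(q.*2)) :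
      std_form z z' = \sum_i pot z i * cur z' i - \sum_i pot z' i * cur z i.
    by rewrite /std_form sumrB.
  rewrite !E; under eq_bigr do rewrite h1.
  under [X in - (_ - X)]eq_bigr do rewrite h1'.
  under [X in _ + (X - _)]eq_bigr do rewrite h2.
  under [X in _ + (_ - X)]eq_bigr do rewrite h2'.
  have t1 : \sum_i p (inp A i) * cur x' i - \sum_j p (out A j) * cur y' j =
            \sum_e - (lab A e * c e * c' e).
    apply/eqP; rewrite subr_eq addrC; apply/eqP.
    apply: (addIr (\sum_e p (tgt A e) * c' e)); rewrite h4' -addrA; congr (_ + _).
    by rewrite -big_split; apply: eq_bigr => e _ /=; rewrite -h3; ring.
  have t2 : \sum_i p' (inp A i) * cur x i - \sum_j p' (out A j) * cur y j =
            \sum_e - (lab A e * c e * c' e).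
    apply/eqP; rewrite subr_eq addrC; apply/eqP.
    apply: (addIr (\sum_e p' (tgt A e) * c e)); rewrite h4 -addrA; congr (_ + _).
    rewrite -big_split; apply: eq_bigr => e _ /=.
    by rewrite [_ * c e * _]mulrAC -h3'; ring.
  rewrite opprB [X in _ + X]addrC addrACA t2 [X in _ + X]addrC -opprB t1.
  by rewrite subrr.
move=> x y H; apply/bb_relP.
pose C : finType := (edge A + node A)%type.
pose T : finType := ((node A + edge A) + ('I_m + 'I_n))%type.
pose inc (e : edge A) (v : node A) : k := (tgt A e == v)%:R - (src A e == v)%:R.
pose M (j : C) (t : T) : k :=
  match j, t with
  | inl e, inl (inl v) => inc e v
  | inl e, inl (inr e') => - (lab A e * (e == e')%:R)
  | inl e, inr _ => 0
  | inr v, inl (inl _) => 0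
  | inr v, inl (inr e) => inc e v
  | inr v, inr (inl i) => (inp A i == v)%:R
  | inr v, inr (inr j) => - (out A j == v)%:R
  end.
pose c (t : T) : k :=
  match t with
  | inl (inl v) => \sum_j cur y j * (out A j == v)%:R - \sum_i cur x i * (inp A i == v)%:R
  | inl (inr e) => 0
  | inr (inl i) => pot x i
  | inr (inr j) => - pot y j
  end.
have [t Ht|z Hz] := @fredholm _ _ _ M c.
  pose p v := t (inl (inl v)); pose f e := t (inl (inr e)).
  pose a i := t (inr (inl i)); pose b j := t (inr (inr j)).
  pose x' : 'rV[k]_(m.*2) := mkrow (fun i => p (inp A i)) a.
  pose y' : 'rV[k]_(n.*2) := mkrow (fun j => p (out A j)) b.
  have xy' : (x', y') \in bb_rel A.
    apply/bb_relP; exists p, f; split=> [i|j|e|w] /=.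
    - by rewrite pot_mkrow.
    - by rewrite pot_mkrow.
    - have := Ht (inl e); rewrite !big_sumType /=.
      rewrite [X in _ + (X + _)]big1 ?[X in _ + (_ + X)]big1; try by move=> *; rewrite mul0r.
      rewrite !addr0 => /eqP; rewrite addr_eq0 => /eqP h.
      transitivity (\sum_v inc e v * p v).
        under [RHS]eq_bigr do rewrite mulrC mulrBr.
        by rewrite sumrB !sum_delta.
      rewrite h -sumrN; under eq_bigr do rewrite mulNr opprK mulrAC.
      by rewrite sum_delta.
    - have h v : \sum_e inc e v * f e +
          (\sum_i (inp A i == v)%:R * a i + \sum_j - (out A j == v)%:R * b j) = 0.
        have := Ht (inr v); rewrite !big_sumType /= [X in X + _ + _]big1 ?add0r //.
        by move=> *; rewrite mul0r.
      have h0 : \sum_v w v * (\sum_e inc e v * f e +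
          (\sum_i (inp A i == v)%:R * a i + \sum_j - (out A j == v)%:R * b j)) = 0.
        by apply: big1 => v _; rewrite h mulr0.
      have E (I : finType) (g : I -> node A -> k) (s : I -> k) :
          \sum_v w v * (\sum_i g i v * s i) = \sum_i (\sum_v w v * g i v) * s i.
        under eq_bigr do rewrite mulr_sumr.
        rewrite exchange_big; apply: eq_bigr => i _; rewrite mulr_suml.
        by apply: eq_bigr => v _; rewrite mulrA.
      have D1 e : \sum_v w v * inc e v = w (tgt A e) - w (src A e).
        under eq_bigr do rewrite mulrBr.
        by rewrite sumrB !sum_delta.
      have D2 j : \sum_v w v * - (out A j == v)%:R = - w (out A j).
        by under eq_bigr do rewrite mulrN; rewrite sumrN sum_delta.
      move: h0; under [X in X = _ -> _]eq_bigr do rewrite !mulrDr.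
      rewrite !big_split /= !E.
      under [X in X + _ = _ -> _]eq_bigr do rewrite D1 mulrBl.
      under [X in _ + (X + _) = _ -> _]eq_bigr do rewrite sum_delta.
      under [X in _ + (_ + X) = _ -> _]eq_bigr do rewrite D2 mulNr.
      rewrite sumrB sumrN => h0.
      under [X in X + _ = _]eq_bigr do rewrite cur_mkrow.
      under [X in _ = X + _]eq_bigr do rewrite cur_mkrow.
      apply/eqP; rewrite -subr_eq0; apply/eqP; rewrite -[RHS]h0; ring.
  rewrite -[RHS](H _ _ xy') !big_sumType /=.
  rewrite [X in _ + X + _ = _]big1 ?addr0; last by move=> *; rewrite mul0r.
  rewrite /std_form !sumrB.
  under [X in _ = - (X - _) + _]eq_bigr do rewrite pot_mkrow.
  under [X in _ = - (_ - X) + _]eq_bigr do rewrite cur_mkrow.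
  under [X in _ = _ + (X - _)]eq_bigr do rewrite pot_mkrow.
  under [X in _ = _ + (_ - X)]eq_bigr do rewrite cur_mkrow.
  have E (I : finType) (g : I -> node A) (s : I -> k) :
     \sum_v (\sum_i s i * (g i == v)%:R) * p v = \sum_i p (g i) * s i.
    under eq_bigr do rewrite mulr_suml.
    rewrite exchange_big; apply: eq_bigr => i _.
    rewrite -[in RHS](sum_delta (g i) p) mulr_suml; apply: eq_bigr => v _.
    ring.
  under eq_bigr do rewrite mulrBl.
  rewrite sumrB !E; under [X in _ + (_ + X) = _]eq_bigr do rewrite mulNr.
  rewrite sumrN; ring.
exists (fun v => z (inr v)), (fun e => z (inl e)); split=> [i|j|e|w] /=.
- have := Hz (inr (inl i)); rewrite big_sumType /= => ->.
  rewrite [X in X + _]big1 ?add0r; last by move=> *; rewrite mulr0.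
  by rewrite sum_delta.
- have := Hz (inr (inr j)); rewrite big_sumType /= => /(congr1 -%R); rewrite opprK => ->.
  rewrite [X in X + _]big1 ?add0r; last by move=> *; rewrite mulr0.
  by rewrite -sumrN; under eq_bigr do rewrite mulrN opprK; rewrite sum_delta.
- have := Hz (inl (inr e)); rewrite big_sumType /=.
  under [X in _ = _ + X -> _]eq_bigr do rewrite mulrBr.
  rewrite sumrB !sum_delta => /esym/eqP; rewrite addr_eq0 => /eqP h.
  rewrite -[LHS]opprK -h -sumrN.
  under eq_bigr do rewrite mulrN opprK mulrA eq_sym.
  by rewrite sum_delta mulrC.
- have h v := Hz (inl (inl v)).
  have : \sum_v w v * c (inl (inl v)) = \sum_v w v * (\sum_j z j * M j (inl (inl v))).
    by apply: eq_bigr => v _; rewrite h.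
  have E (I : finType) (g : I -> node A) (s : I -> k) :
     \sum_v w v * (\sum_i s i * (g i == v)%:R) = \sum_i w (g i) * s i.
    under eq_bigr do rewrite mulr_sumr.
    rewrite exchange_big; apply: eq_bigr => i _.
    rewrite -[in RHS](sum_delta (g i) w) mulr_suml; apply: eq_bigr => v _.
    ring.
  rewrite /=; under eq_bigr do rewrite mulrBr.
  rewrite sumrB !E; under [RHS]eq_bigr do (rewrite big_sumType /= [X in _ + X]big1 ?addr0;
    last by move=> *; rewrite mulr0).
  under [RHS]eq_bigr do (under eq_bigr do rewrite mulrBr; rewrite sumrB mulrBr).
  rewrite sumrB !E => /eqP h0.
  apply/eqP; rewrite -subr_eq0; move: h0; rewrite -subr_eq0 => /eqP h0.
  apply/eqP; rewrite -[RHS]oppr0 -[in RHS]h0; ring.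
Qed.

Lemma lagrangian_sub_eq m n (R S : linrel k m.*2 n.*2) :
  lagrangian (@lagrel_form k m n) R -> lagrangian (@lagrel_form k m n) S ->
  (forall x y, (x, y) \in R -> (x, y) \in S) -> R = S.
Proof.
move=> [_ maxR] [isoS _] RS; apply/esym/maxR => //.
by apply/subvP => -[x y]; apply: RS.
Qed.

Definition bb_hom m n (A : Circ k m n) : LagRel k m n :=
  exist _ (bb_rel A) (bb_lagrangian A).

Lemma bb_eqv m n (A B : circuit k m n) : circ_iso A B -> bb_rel A = bb_rel B.
Proof.
move=> [a [e [[a' aK a'K] be [h1 h2] [h3 h4] h5]]].
apply: lagrangian_sub_eq; try exact: bb_lagrangian.
move=> x y /bb_relP[p [c [/= k1 k2 k3 k4]]]; apply/bb_relP.
case: be => e' eK e'K.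
exists (p \o a'), (c \o e'); split=> [i|j|f|w] /=.
- by rewrite k1 -h1 aK.
- by rewrite k2 -h2 aK.
- by rewrite -[f]e'K -h3 -h4 -h5 !aK !eK.
- have := k4 (w \o a) => /=.
  under [X in X + _ = _ -> _]eq_bigr do rewrite h1.
  under [X in _ + X = _ -> _]eq_bigr do rewrite h4.
  under [X in _ = X + _ -> _]eq_bigr do rewrite h2.
  under [X in _ = _ + X -> _]eq_bigr do rewrite h3.
  have R (g : edge B -> k) : \sum_f g f * c (e' f) = \sum_f g (e f) * c f.
    rewrite (reindex e) /=; last by apply: onW_bij; exists e'.
    by apply: eq_bigr => f _; rewrite eK.
  by rewrite !R.
Qed.

Lemma bb_id n : bb_rel (circ_id k n) = id_rel k n.*2.
Proof.
apply: lagrangian_sub_eq; [exact: bb_lagrangian | exact: lagrangian_id |].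
move=> x y /bb_relP[p [c [/= k1 k2 k3 k4]]]; apply/id_relP/potcur_ext => i.
  by rewrite k1 k2.
have := k4 (fun j => (i == j)%:R).
rewrite [X in _ + X]big1 1?[X in _ = _ + X]big1; [|by case..].
rewrite !addr0; under eq_bigr do rewrite mulrC.
by rewrite sum_delta; under eq_bigr do rewrite mulrC; rewrite sum_delta.
Qed.

Lemma bb_comp m n p (A : circuit k m n) (B : circuit k n p) :
  bb_rel (circ_comp A B) = comp_rel (bb_rel A) (bb_rel B).
Proof.
apply/esym/lagrangian_sub_eq; last 1 first.
- move=> x z /comp_relP[y [/bb_relP[p1 [c1 [/= k1 k2 k3 k4]]] /bb_relP[p2 [c2 [/= h1 h2 h3 h4]]]]].
  have [|q [qa qb]] := @po_univ _ _ _ (out A) (inp B) _ p1 p2.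
    by move=> i; rewrite -k2 h1.
  apply/bb_relP; exists q, (fun e => match e with inl e => c1 e | inr e => c2 e end).
  split=> [i|j|e|w] /=.
  + by rewrite k1 qa.
  + by rewrite h2 qb.
  + by case: e => e; rewrite ?qa ?qb.
  + have := k4 (w \o po_inl _ _); have := h4 (w \o po_inr _ _) => /=.
    rewrite !big_sumType /=.
    under [X in X + _ = _ -> _]eq_bigr do rewrite -po_glue.
    by move=> e1 e2; rewrite addrA e2 addrAC e1 -addrA [X in _ + X = _]addrC.
- exact: lagrangian_comp (bb_lagrangian _) (bb_lagrangian _).
- exact: bb_lagrangian.
Qed.

Lemma bb_tens m n m' n' (A : circuit k m n) (B : circuit k m' n') :
  bb_rel (circ_tens A B) =
  castm (esym (doubleD m m')) (esym (doubleD n n')) (tens_rel (bb_rel A) (bb_rel B)).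
Proof.
have spl a b (j : 'I_a) : split (lshift b j) = inl j by apply: (unsplitK (inl j)).
have spr a b (j : 'I_b) : split (rshift a j) = inr j by apply: (unsplitK (inr j)).
apply/esym/lagrangian_sub_eq; last 1 first.
- move=> x z /dtens_relP[/bb_relP[p1 [c1 [/= k1 k2 k3 k4]]] /bb_relP[p2 [c2 [/= h1 h2 h3 h4]]]].
  apply/bb_relP; exists (fun u => match u with inl v => p1 v | inr v => p2 v end),
    (fun e => match e with inl e => c1 e | inr e => c2 e end).
  split=> [i|j|e|w] /=.
  + rewrite -[in LHS](splitK i); case: (split i) => a /=.
      by rewrite -pot_dlsub k1.
    by rewrite -pot_drsub h1.
  + rewrite -[in LHS](splitK j); case: (split j) => a /=.
      by rewrite -pot_dlsub k2.
    by rewrite -pot_drsub h2.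
  + by case: e => e /=.
  + have := k4 (w \o inl); have := h4 (w \o inr) => /=.
    rewrite !big_sumType !big_split_ord /=.
    under [X in _ -> _ -> X + _ + _ = _]eq_bigr do rewrite spl -cur_dlsub.
    under [X in _ -> _ -> _ + X + _ = _]eq_bigr do rewrite spr -cur_drsub.
    under [X in _ -> _ -> _ = X + _ + _]eq_bigr do rewrite spl -cur_dlsub.
    under [X in _ -> _ -> _ = _ + X + _]eq_bigr do rewrite spr -cur_drsub.
    by move=> e1 e2 /=; rewrite addrACA e2 e1 addrACA.
- exact: lagrangian_tens (bb_lagrangian _) (bb_lagrangian _).
- exact: bb_lagrangian.
Qed.

Lemma bb_swap m n :
  bb_rel (circ_swap k m n) =
  castm (esym (doubleD m n)) (esym (doubleD n m)) (swap_rel k m.*2 n.*2).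
Proof.
have spl a b (j : 'I_a) : split (lshift b j) = inl j by apply: (unsplitK (inl j)).
have spr a b (j : 'I_b) : split (rshift a j) = inr j by apply: (unsplitK (inr j)).
apply/esym/lagrangian_sub_eq; last 1 first.
- move=> x y /dswap_relP[e1 e2]; apply/bb_relP.
  have pl i : pot y (lshift m i) = pot x (rshift m i).
    by rewrite -pot_dlsub -pot_drsub e2.
  have pr i : pot y (rshift n i) = pot x (lshift n i).
    by rewrite -pot_dlsub -pot_drsub e1.
  have cl i : cur y (lshift m i) = cur x (rshift m i).
    by rewrite -cur_dlsub -cur_drsub e2.
  have cr i : cur y (rshift n i) = cur x (lshift n i).
    by rewrite -cur_dlsub -cur_drsub e1.
  exists (pot x), (of_void k); split=> //= [j|w].
  + rewrite /swap_ord -[in LHS](splitK j); case: (split j) => a /=; rewrite ?pl ?pr //.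
  + rewrite [X in _ + X]big1 1?[X in _ = _ + X]big1; [|by case..].
    rewrite !addr0 !big_split_ord /= addrC /swap_ord; congr (_ + _);
      apply: eq_bigr => i _; rewrite ?spl ?spr ?cl ?cr //.
- exact: lagrangian_swap.
- exact: bb_lagrangian.
Qed.

Definition blackbox : prop_morph (Circ k) (LagRel k) :=
  @PropMorph (Circ k) (LagRel k) bb_hom bb_eqv bb_id bb_comp bb_tens bb_swap.

Lemma blackboxP : is_blackbox blackbox.
Proof.
split.
- move=> p1 i1 p2 i2 p3 i3; rewrite bb_relP; split.
  + move=> [p [c [/= k1 k2 k3 k4]]].
    have := k1 0; have := k1 1; have := k2 0; rewrite /pot !mxE /= => <- -> <-.
    split=> //; have := k4 (fun=> 1).
    rewrite !big_ord_recl !big_ord0 [X in _ + X]big1 1?[X in _ = _ + X]big1; [|by case..].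
    by rewrite /cur !mxE /= !addr0 !mul1r.
  + move=> [<- <- <-]; exists (fun=> p1), (of_void k).
    split=> [i|j|[]//|w].
    * by case: i => -[|[|]] //= ?; rewrite /pot mxE.
    * by case: j => -[|] //= ?; rewrite /pot mxE.
    * rewrite !big_ord_recl !big_ord0 [X in _ + X]big1 1?[X in _ = _ + X]big1; [|by case..].
      by rewrite /cur !mxE /= !addr0 mulrDr.
- move=> p2 i2; rewrite bb_relP; split.
  + move=> [p [c [/= k1 k2 k3 k4]]]; have := k4 (fun=> 1).
    rewrite !big_ord_recl !big_ord0 [X in _ + X]big1 1?[X in _ = _ + X]big1; [|by case..].
    by rewrite /cur !mxE /= !addr0 !mul1r.
  + move=> ->; exists (fun=> p2), (of_void k).
    split=> [[]//|j|[]//|w].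
    * by case: j => -[|] //= ?; rewrite /pot mxE.
    * rewrite !big_ord_recl !big_ord0 [X in _ + X]big1 1?[X in _ = _ + X]big1; [|by case..].
      by rewrite /cur !mxE /= !addr0 mulr0.
- move=> p1 i1 p2 i2 p3 i3; rewrite bb_relP; split.
  + move=> [p [c [/= k1 k2 k3 k4]]].
    have := k1 0; have := k2 1; have := k2 0; rewrite /pot !mxE /= => -> -> ->.
    split=> //; have := k4 (fun=> 1).
    rewrite !big_ord_recl !big_ord0 [X in _ + X]big1 1?[X in _ = _ + X]big1; [|by case..].
    by rewrite /cur !mxE /= !addr0 !mul1r.
  + move=> [<- <- ->]; exists (fun=> p1), (of_void k).
    split=> [i|j|[]//|w].
    * by case: i => -[|] //= ?; rewrite /pot mxE.
    * by case: j => -[|[|]] //= ?; rewrite /pot mxE.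
    * rewrite !big_ord_recl !big_ord0 [X in _ + X]big1 1?[X in _ = _ + X]big1; [|by case..].
      by rewrite /cur !mxE /= !addr0 mulrDr.
- move=> p1 i1; rewrite bb_relP; split.
  + move=> [p [c [/= k1 k2 k3 k4]]]; have := k4 (fun=> 1).
    rewrite !big_ord_recl !big_ord0 [X in _ + X]big1 1?[X in _ = _ + X]big1; [|by case..].
    by rewrite /cur !mxE /= !addr0 !mul1r.
  + move=> ->; exists (fun=> p1), (of_void k).
    split=> [i|[]//|[]//|w].
    * by case: i => -[|] //= ?; rewrite /pot mxE.
    * rewrite !big_ord_recl !big_ord0 [X in _ + X]big1 1?[X in _ = _ + X]big1; [|by case..].
      by rewrite /cur !mxE /= !addr0 mulr0.
- move=> z p1 i1 p2 i2; rewrite bb_relP; split.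
  + move=> [p [c [/= k1 k2 k3 k4]]].
    have := k1 0; have := k2 0; have := k3 tt; rewrite /pot !mxE /= => h -> ->.
    have := k4 (fun j => (j == ord0)%:R); have := k4 (fun j => (j == ord_max)%:R).
    have U (f : unit -> k) : \sum_e f e = f tt.
      by rewrite (bigD1 tt) //= big1 ?addr0 // => -[].
    rewrite !big_ord_recl !big_ord0 !U /cur !mxE /= !mul1r !mul0r !addr0 !add0r.
    by move=> e1 e2; rewrite h e2.
  + move=> [h <-]; exists (fun j => if j == ord0 then p1 else p2), (fun=> i1).
    have U (f : unit -> k) : \sum_e f e = f tt.
      by rewrite (bigD1 tt) //= big1 ?addr0 // => -[].
    split=> [i|j|e|w] /=.
    * by case: i => -[|] //= ?; rewrite /pot mxE.
    * by case: j => -[|] //= ?; rewrite /pot mxE.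
    * by rewrite h.
    * by rewrite !big_ord_recl !big_ord0 !U /cur !mxE /= !addr0 addrC.
Qed.

Lemma blackbox_exists : exists B : prop_morph (Circ k) (LagRel k), is_blackbox B.
Proof. by exists blackbox; apply: blackboxP. Qed.

End Blackbox.

(* Main.v *)
Require Import Defs.
From mathcomp Require Import all_boot all_order all_algebra.

(** The prop for circuits before the Frobenius laws is freely generated by
    [Mu], [Iota], [Delta], [Epsilon] and one resistor for each scalar, so a
    functor out of it is determined by, and may be freely prescribed on, these
    generators.  Since black-boxing sends a wire to a pair (potential,
    current), the functor [T] has to double objects; a functor that doubles
    objects is the same thing as a morphism of props into the pullback of the
    target along doubling ([pull_prop]), and therefore [T] is given by the
    universal property, once a signal-flow diagram has been chosen for each
    generator ([node_diagram], [resistor_diagram]).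

    The diagrams treat the two components of a wire separately: at a junction
    the potentials are (co)duplicated and the currents are (co)added; along a
    resistor of resistance [z] the current is copied, one copy is scaled by
    [z] and added to the potential.

    Both ways around the square are morphisms of props into the pullback of
    [FinRel], so they agree as soon as they agree on generators
    ([coprod_free_ext]).  There they are compared as explicit systems of linear
    equations: [solves R P] says that the linear relation [R] is cut out by the
    condition [P] on coordinates, and this is computed compositionally for any
    diagram ([solves_comp], [solves_tens]). *)

Set Implicit Arguments.
Unset Strict Implicit.
Unset Printing Implicit Defensive.

Import GRing.Theory.
Local Open Scope ring_scope.

(** * Morphisms of props *)

Definition pm_comp (A B C : propcat) (F : prop_morph A B) (G : prop_morph B C) :
  prop_morph A C :=
  @PropMorph A C (fun m n f => G m n (F m n f))
    (fun _ _ _ _ e => pm_eqv G (pm_eqv F e))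
    (fun _ => eqv_trans (pm_eqv G (pm_id F _)) (pm_id G _))
    (fun _ _ _ _ _ => eqv_trans (pm_eqv G (pm_pcomp F _ _)) (pm_pcomp G _ _))
    (fun _ _ _ _ _ _ => eqv_trans (pm_eqv G (pm_tens F _ _)) (pm_tens G _ _))
    (fun _ _ => eqv_trans (pm_eqv G (pm_swap F _ _)) (pm_swap G _ _)).

Lemma free_ext (S : signature) (C : propcat) (F G : prop_morph (free_prop S) C) :
  (forall m n (s : S m n), eqv (F m n (TGen s)) (G m n (TGen s))) ->
  forall m n (f : free_prop S m n), eqv (F m n f) (G m n f).
Proof.
move=> FG m n f; pose g p q (s : S p q) := G p q (TGen s).
have EF := presented_lift_unique (g := g) (fun _ _ _ _ => False_ind _) FG f.
apply: eqv_trans EF (eqv_sym _).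
by apply: presented_lift_unique => p q s; apply: eqv_refl.
Qed.

Lemma coprod_free_ext (S S' : signature) (C : propcat)
    (F G : prop_morph (coprod (free_prop S) (free_prop S')) C) :
  let inl := coprod_inl (free_prop S) (free_prop S') in
  let inr := coprod_inr (free_prop S) (free_prop S') in
  (forall m n (s : S m n),
    eqv (F m n (inl m n (TGen s))) (G m n (inl m n (TGen s)))) ->
  (forall m n (s : S' m n),
    eqv (F m n (inr m n (TGen s))) (G m n (inr m n (TGen s)))) ->
  forall m n (f : coprod (free_prop S) (free_prop S') m n),
    eqv (F m n f) (G m n f).
Proof.
move=> inl inr FGl FGr m n f.
pose Gl := pm_comp inl G; pose Gr := pm_comp inr G.
apply: (@eqv_trans _ _ _ _ (copair Gl Gr m n f)); last first.
  by apply: eqv_sym; apply: copair_unique => p q g; apply: eqv_refl.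
apply: copair_unique => p q g.
- exact: (free_ext (F := pm_comp inl F) (G := Gl)).
- exact: (free_ext (F := pm_comp inr F) (G := Gr)).
Qed.

Section PullbackMorphisms.
Variables (d : nat -> nat).
Hypotheses (d0 : d 0%N = 0%N) (dD : forall m n, d (m + n)%N = (d m + d n)%N).

(** The two notions differ only in where the casts along [dD] are recorded: in
    the laws of the functor or in the tensor product of the pullback. *)
Definition smf_of_pull (A B : propcat) (F : prop_morph A (pull_prop B d0 dD)) :
  smfunctor A B :=
  @SMFunctor A B d d0 dD (@pm _ _ F) (@pm_eqv _ _ F) (@pm_id _ _ F)
    (@pm_pcomp _ _ F) (@pm_tens _ _ F) (@pm_swap _ _ F).

Definition pull_pm (B C : propcat) (G : prop_morph B C) :
  prop_morph (pull_prop B d0 dD) (pull_prop C d0 dD).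
Proof.
apply: (@PropMorph (pull_prop B d0 dD) (pull_prop C d0 dD)
  (fun m n f => G (d m) (d n) f)).
- by move=> m n; apply: (@pm_eqv _ _ G).
- by move=> n; apply: (pm_id G).
- by move=> m n p; apply: (@pm_pcomp _ _ G).
- move=> m n m' n' f g; rewrite /= /pull_tens (castm_fhom (@pm _ _ G)).
  exact/castm_eqv/pm_tens.
- move=> m n; rewrite /= /pull_swap (castm_fhom (@pm _ _ G)).
  exact/castm_eqv/pm_swap.
Defined.

End PullbackMorphisms.

Definition lagrel_pm (k : fieldType) :
  prop_morph (LagRel k) (pull_prop (FinRel k) (erefl : 0.*2 = 0)%N doubleD) :=
  @PropMorph (LagRel k) (pull_prop (FinRel k) (erefl : 0.*2 = 0)%N doubleD)
    (fun m n R => sval R)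
    (fun _ _ _ _ => id) (fun _ => erefl) (fun _ _ _ _ _ => erefl)
    (fun _ _ _ _ _ _ => erefl) (fun _ _ => erefl).

(** * Linear relations given by equations *)

Section Equations.
Variable k : fieldType.

(** Excess entries of the list are dropped, so that the left block of a row is
    the row of the same list and no list has to be cut at its length. *)
Definition seqrow n (s : seq k) : 'rV[k]_n := \row_j s`_j.

Lemma seqrowP n (x : 'rV[k]_n) : exists s, x = seqrow n s.
Proof.
exists [seq x 0 i | i : 'I_n]; apply/rowP => i; rewrite mxE.
by rewrite (nth_map i) ?size_enum_ord // nth_ord_enum.
Qed.

Lemma seqrow_eq n (s t : seq k) :
  seqrow n s = seqrow n t <-> forall i, (i < n)%N -> s`_i = t`_i.
Proof.
split=> [/rowP st i ni | st].
  by have := st (Ordinal ni); rewrite !mxE.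
by apply/rowP => i; rewrite !mxE st.
Qed.

Lemma lsubmx_seqrow m n (s : seq k) : lsubmx (seqrow (m + n) s) = seqrow m s.
Proof. by apply/rowP => i; rewrite !mxE. Qed.

Lemma rsubmx_seqrow m n (s : seq k) :
  rsubmx (seqrow (m + n) s) = seqrow n (drop m s).
Proof. by apply/rowP => i; rewrite !mxE nth_drop. Qed.

Definition solves m n (R : linrel k m n) (P : seq k -> seq k -> Prop) : Prop :=
  forall s t, (seqrow m s, seqrow n t) \in R <-> P s t.

Lemma solves_inj m n (R R' : linrel k m n) P P' :
  solves R P -> solves R' P' -> (forall s t, P s t <-> P' s t) -> R = R'.
Proof.
move=> RP RP' PP'; apply: linrelP => x y.
by case: (seqrowP x) => s ->; case: (seqrowP y) => t ->; rewrite RP RP' PP'.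
Qed.

Lemma solves_comp m n p (R : linrel k m n) (R' : linrel k n p) P P' :
  solves R P -> solves R' P' ->
  solves (comp_rel R R') (fun s t => exists u, P s u /\ P' u t).
Proof.
move=> RP RP' s t; rewrite comp_relP; split=> [[y []] | [u [su ut]]].
  by case: (seqrowP y) => u -> /RP su /RP' ut; exists u.
by exists (seqrow n u); split; [apply/RP | apply/RP'].
Qed.

Lemma solves_tens m n m' n' (R : linrel k m n) (R' : linrel k m' n') P P' :
  solves R P -> solves R' P' ->
  solves (tens_rel R R') (fun s t => P s t /\ P' (drop m s) (drop n t)).
Proof.
by move=> RP RP' s t; rewrite tens_relP !lsubmx_seqrow !rsubmx_seqrow RP RP'.
Qed.

Lemma solves_id1 : solves (id_rel k 1) (fun s t => s`_0 = t`_0).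
Proof.
move=> s t; rewrite id_relP seqrow_eq; split=> [st|st [|i] //].
exact: st.
Qed.

Lemma solves_swap11 :
  solves (swap_rel k 1 1) (fun s t => s`_0 = t`_1 /\ s`_1 = t`_0).
Proof.
move=> s t; rewrite swap_relP !lsubmx_seqrow !rsubmx_seqrow !seqrow_eq.
split=> [[st ts] | [st ts]].
  by have := st 0%N isT; have := ts 0%N isT; rewrite !nth_drop.
by split=> -[|i] //; rewrite nth_drop.
Qed.

Lemma seqrow0 (s : seq k) : seqrow 0 s = rvec [::].
Proof. exact: rvec0. Qed.

Lemma seqrow1 (s : seq k) : seqrow 1 s = rvec [:: s`_0].
Proof. by apply/rowP => -[[|i] //= ?]; rewrite !mxE. Qed.

Lemma seqrow2 (s : seq k) : seqrow 2 s = rvec [:: s`_0; s`_1].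
Proof. by apply/rowP => -[[|[|i]] //= ?]; rewrite !mxE. Qed.

Lemma seqrow4 (s : seq k) : seqrow 4 s = rvec [:: s`_0; s`_1; s`_2; s`_3].
Proof. by apply/rowP => -[[|[|[|[|i]]]] //= ?]; rewrite !mxE. Qed.

Lemma rvec1_inj (x y : k) : rvec [:: x] = rvec [:: y] -> x = y.
Proof. by move=> /rowP/(_ 0); rewrite !mxE. Qed.

Lemma rvec2_inj (x y x' y' : k) :
  rvec [:: x; y] = rvec [:: x'; y'] -> x = x' /\ y = y'.
Proof. by move=> /rowP e; have := e 0; have := e 1; rewrite !mxE. Qed.

Lemma solves_codup :
  solves (dup_gen k Mu) (fun s t => s`_0 = t`_0 /\ s`_1 = t`_0).
Proof.
move=> s t; rewrite subspaceP /codup_set seqrow2 seqrow1.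
split=> [[x [/rvec2_inj[-> ->] /rvec1_inj->]] // | [-> ->]].
by exists t`_0.
Qed.

Lemma solves_codel : solves (dup_gen k Iota) (fun s t => True).
Proof.
move=> s t; rewrite subspaceP /codel_set seqrow0 seqrow1.
by split=> // _; exists t`_0.
Qed.

Lemma solves_dup :
  solves (dup_gen k Delta) (fun s t => t`_0 = s`_0 /\ t`_1 = s`_0).
Proof.
move=> s t; rewrite subspaceP /dup_set seqrow2 seqrow1.
split=> [[x [/rvec1_inj-> /rvec2_inj[-> ->]]] // | [-> ->]].
by exists s`_0.
Qed.

Lemma solves_del : solves (dup_gen k Epsilon) (fun s t => True).
Proof.
move=> s t; rewrite subspaceP /del_set seqrow0 seqrow1.
by split=> // _; exists s`_0.
Qed.

Lemma solves_add : solves (add_gen k Mu) (fun s t => s`_0 + s`_1 = t`_0).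
Proof.
move=> s t; rewrite subspaceP /add_set seqrow2 seqrow1.
split=> [[x [y [/rvec2_inj[-> ->] /rvec1_inj->]]] // | <-].
by exists s`_0, s`_1.
Qed.

Lemma solves_zero : solves (add_gen k Iota) (fun s t => t`_0 = 0).
Proof.
move=> s t; rewrite subspaceP /zero_set seqrow0 seqrow1.
by split=> [[/rvec1_inj] | ->].
Qed.

Lemma solves_coadd : solves (add_gen k Delta) (fun s t => s`_0 = t`_0 + t`_1).
Proof.
move=> s t; rewrite subspaceP /coadd_set seqrow2 seqrow1.
split=> [[x [y [/rvec1_inj-> /rvec2_inj[-> ->]]]] // | ->].
by exists t`_0, t`_1.
Qed.

Lemma solves_cozero : solves (add_gen k Epsilon) (fun s t => s`_0 = 0).
Proof.
move=> s t; rewrite subspaceP /cozero_set seqrow0 seqrow1.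
by split=> [[/rvec1_inj] | ->].
Qed.

Lemma solves_scal c : solves (scal_op (Op c)) (fun s t => t`_0 = c * s`_0).
Proof.
move=> s t; rewrite subspaceP /scal_set !seqrow1.
by split=> [[x [/rvec1_inj-> /rvec1_inj->]] // | ->]; exists s`_0.
Qed.

End Equations.

(** * Signal-flow diagrams of circuit elements *)

Section Diagrams.
Variable k : fieldType.

Definition dupl m n (s : Sigma m n) : SigFlow k m n :=
  coprod_inl _ _ _ _ (coprod_inl (free_prop Sigma) _ _ _ (TGen s)).
Definition addl m n (s : Sigma m n) : SigFlow k m n :=
  coprod_inl _ _ _ _ (coprod_inr _ (free_prop Sigma) _ _ (TGen s)).
Definition scal (c : k) : SigFlow k 1 1 :=
  coprod_inr _ (free_prop (unary_sig k)) _ _ (TGen (Op c)).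

(** Exchanges (potential, current, potential, current) with (potential,
    potential, current, current); the same diagram serves in both directions. *)
Definition middle_swap : SigFlow k 4 4 :=
  tens (tens (idm 1%N) (swap 1 1)) (idm 1%N).

Definition node_diagram m n (s : Sigma m n) : SigFlow k m.*2 n.*2 :=
  match s in Sigma m n return SigFlow k m.*2 n.*2 with
  | Mu => Defs.pcomp middle_swap (tens (dupl Mu) (addl Mu))
  | Iota => tens (dupl Iota) (addl Iota)
  | Delta => Defs.pcomp (tens (dupl Delta) (addl Delta)) middle_swap
  | Epsilon => tens (dupl Epsilon) (addl Epsilon)
  end.

Definition resistor_diagram m n (s : unary_sig k m n) : SigFlow k m.*2 n.*2 :=
  match s in unary_sig _ m n return SigFlow k m.*2 n.*2 with
  | Op z => Defs.pcomp (Defs.pcomp (tens (idm 1%N) (dupl Delta))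
                         (tens (tens (idm 1%N) (scal z)) (idm 1%N)))
                  (tens (addl Mu) (idm 1%N))
  end.

Definition circuit_diagram :
  prop_morph (CircTilde k) (pull_prop (SigFlow k) (erefl : 0.*2 = 0)%N doubleD) :=
  @copair _ _ (pull_prop (SigFlow k) (erefl : 0.*2 = 0)%N doubleD)
    (@free_lift _ (pull_prop (SigFlow k) (erefl : 0.*2 = 0)%N doubleD) node_diagram)
    (@free_lift _ (pull_prop (SigFlow k) (erefl : 0.*2 = 0)%N doubleD) resistor_diagram).

Lemma solves_middle_swap :
  solves (sigflow_box k 4 4 middle_swap)
    (fun s t => (s`_0 = t`_0 /\ s`_1 = t`_2 /\ s`_2 = t`_1) /\ s`_3 = t`_3).
Proof.
have H := solves_tens (solves_tens (@solves_id1 k) (@solves_swap11 k)) (@solves_id1 k).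
by move=> s t; rewrite (H s t) !nth_drop.
Qed.

Variables (B : prop_morph (Circ k) (LagRel k)) (hB : is_blackbox B).

Lemma node_diagram_blackbox m n (s : Sigma m n) :
  sigflow_box k _ _ (node_diagram s) = lagrel_space (B m n (circ_gen k s)).
Proof.
case: s => /=.
- apply: solves_inj.
  + apply: solves_comp solves_middle_swap _.
    exact: solves_tens (@solves_codup k) (@solves_add k).
  + move=> s t; rewrite seqrow4 seqrow2; exact: (blackbox_mu hB).
  + move=> s t; split=> [[u] | [e1 e2 e3]].
      rewrite /= !nth_drop => -[[[-> [-> ->]] ->] [[-> ->] <-]].
      by split.
    (* The inner wires carry both potentials, then both currents. *)
    by exists [:: s`_0; s`_2; s`_1; s`_3]; rewrite !nth_drop /= e1 e2.
- apply: solves_inj.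
  + exact: solves_tens (@solves_codel k) (@solves_zero k).
  + move=> s t; rewrite seqrow0 seqrow2; exact: (blackbox_iota hB).
  + by move=> s t /=; rewrite nth_drop; split=> [[]|].
- apply: solves_inj.
  + apply: solves_comp solves_middle_swap.
    exact: solves_tens (@solves_dup k) (@solves_coadd k).
  + move=> s t; rewrite seqrow2 seqrow4; exact: (blackbox_delta hB).
  + move=> s t; split=> [[u] | [e1 e2 e3]].
      rewrite /= !(nth_drop, addn0, addn1) => -[[[e0 e1] e2] [[e3 [e4 e5]] e6]].
      by rewrite -e3 -e4 -e5 -e6 e0 e1 e2.
    by exists [:: t`_0; t`_2; t`_1; t`_3]; rewrite !nth_drop /= e1 e2.
- apply: solves_inj.
  + exact: solves_tens (@solves_del k) (@solves_cozero k).
  + move=> s t; rewrite seqrow0 seqrow2; exact: (blackbox_epsilon hB).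
  + by move=> s t /=; rewrite nth_drop; split=> [[]|].
Qed.

Lemma resistor_diagram_blackbox m n (s : unary_sig k m n) :
  sigflow_box k _ _ (resistor_diagram s) = lagrel_space (B m n (circ_op s)).
Proof.
case: s => z /=; apply: solves_inj.
- apply: solves_comp (solves_comp _ _) _.
  + exact: solves_tens (@solves_id1 k) (@solves_dup k).
  + exact: solves_tens (solves_tens (@solves_id1 k) (solves_scal z)) (@solves_id1 k).
  + exact: solves_tens (@solves_add k) (@solves_id1 k).
- move=> s t; rewrite !seqrow2; exact: (blackbox_edge hB).
- move=> s t; split.
    move=> [u [[v []]]]; rewrite !nth_drop.
    move=> [-> [e1 e2]] [[<- ->] <-] [<- <-].
    by rewrite e1 e2 addrC addKr.
  (* With phi and I on the two input wires, the inner wires carry phi, I, I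
     before the scaling and phi, z I, I after it. *)
  move=> [e1 e2]; exists [:: s`_0; z * s`_1; s`_1]; rewrite !nth_drop /=.
  split; last by rewrite -e1 addrC subrK.
  by exists [:: s`_0; s`_1; s`_1]; rewrite !nth_drop.
Qed.

End Diagrams.

Theorem theorem10p3 (k : fieldType)
    (blackbox : prop_morph (Circ k) (LagRel k)) (hblackbox : is_blackbox blackbox) :
  exists T : smfunctor (CircTilde k) (SigFlow k),
    smf_eq
      (smf_comp T (smf_of_pm (sigflow_box k)))
      (smf_comp (smf_of_pm (circ_proj k))
         (smf_comp (smf_of_pm blackbox) (LagRel_incl k))).
Proof.
exists (smf_of_pull (circuit_diagram k)), (fun _ => erefl) => m n f.
rewrite castm_id.
apply: (coprod_free_ext
  (F := pm_comp (circuit_diagram k) (pull_pm _ _ (sigflow_box k)))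
  (G := pm_comp (pm_comp (circ_proj k) blackbox) (lagrel_pm k))) => p q s.
- exact: node_diagram_blackbox hblackbox _ _ s.
- exact: resistor_diagram_blackbox hblackbox _ _ s.
Qed.
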